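(* Let $T=0$, $\epsilon>0$ admissible, and let $\mathbf X(t)=\mathbf X^{(\epsilon)}(t)$ be the Markov chain on $\mathbb N^{n_\epsilon}$ of the context. Let $(X^{(k)}(0))_{k\ge1}$ be deterministic initial conditions in $\mathbb N^{n_\epsilon}$ and $(z_k)_{k\ge1}$ positive integers with $z_k\to\infty$ such that $z_k^{-1}X^{(k)}(0)\to x(0)\in[0,\infty)^{n_\epsilon}$, and let $\mathbf X^{(k)}$ denote the chain started from $X^{(k)}(0)$. Then $\mathcal S(x(0))\neq\emptyset$ and for all $s>0$ and $\delta>0$, $$\lim_{k\to\infty}\mathbb P\Big(\inf_{f\in\mathcal S(x(0))}\ \sup_{t\in[0,s]}\big\|z_k^{-1}\mathbf X^{(k)}(z_kt)-f(t)\big\|_\infty>\delta\Big)=0.$$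
   Context: Setting ($T=0$). $\mathbf S=[-Q,Q]^2$ with opposite edges identified (flat torus), torus distance $\|\cdot\|$. Path-loss $l:[0,\infty)\to[0,\infty)$ bounded, non-increasing, $l(0)=1$; noise $\mathcal N_0>0$; constants $C>0$, $L>0$, $\lambda>0$. Discretization: $\epsilon>0$ is admissible if $2Q/\epsilon$ is an integer; tessellate $\mathbf S$ into $n_\epsilon=(2Q/\epsilon)^2$ squares $A_0,\dots,A_{n_\epsilon-1}$ of side $\epsilon$ with centers $a_i$ and $a_0=0$. Define $l_\epsilon(a_i,a_j)=\sup\{l(\|b-b'\|): b\in\overline{A_i},\,b'\in\overline{A_j}\}$. The chain $\mathbf X$ on $\mathbb N^{n_\epsilon}$ has transitions: for each $i$, $X_i\to X_i+1$ at rate $\lambda\epsilon^2$, and $X_i\to X_i-1$ at rate $\frac{C}{L}X_i\log_2\!\Big(1+\frac{1}{\mathcal N_0+\sum_{j}(X_j-\mathbf 1\{j=i\})\,l_\epsilon(a_i,a_j)}\Big)$. Fluid limits: for $y\in[0,\infty)^{n_\epsilon}$, $\mathcal S(y)$ is the set of functions $x:[0,\infty)\to[0,\infty)^{n_\epsilon}$ with $x(0)=y$ and $x_i(t)=x_i(0)+\lambda\epsilon^2t-D_i(t)$ for non-decreasing Lipschitz functions $D_i$ with $D_i(0)=0$, such that for almost every $t$: if $\|x(t)\|_\infty>0$ then $\dot D_i(t)=\frac{C\,x_i(t)}{L\ln(2)\sum_{k}x_k(t)\,l_\epsilon(a_i,a_k)}$ (interpreted as $0$ when $x_i(t)=0$),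 and if $\|x(t)\|_\infty=0$ then $\dot x_i(t)=0$ for all $i$. *)

(* Defs.v *)
From HB Require Import structures.
From mathcomp Require Import all_boot all_order all_algebra.
From mathcomp Require Import all_classical all_reals all_analysis.
Set Implicit Arguments. Unset Strict Implicit. Unset Printing Implicit Defensive.
Import Order.TTheory GRing.Theory Num.Theory.
Import numFieldNormedType.Exports.
Local Open Scope classical_set_scope.
Local Open Scope ring_scope.

Definition circ_dist (R : realType) (Q : R) (u : R) : R :=
  inf (range (fun m : int => `|u - (2 * Q) * m%:~R|)).

Definition torus_dist (R : realType) (Q : R) (b b' : R * R) : R :=
  Num.sqrt (circ_dist Q (b.1 - b'.1) ^+ 2 + circ_dist Q (b.2 - b'.2) ^+ 2).

(* Tessellation into n_eps = N^2 squares of side eps, N = 2Q/eps.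
   Square i (i < N*N) has center a_i = ((i %/ N) eps, (i %% N) eps)
   (taken modulo the torus), so a_0 = 0. *)
Definition center (R : realType) (eps : R) (N : nat) (i : 'I_(N * N)) : R * R :=
  (((i %/ N)%N)%:R * eps, ((i %% N)%N)%:R * eps).

Definition closed_square (R : realType) (eps : R) (N : nat) (i : 'I_(N * N))
  : set (R * R) :=
  [set b | `|b.1 - (center eps i).1| <= eps / 2 /\
           `|b.2 - (center eps i).2| <= eps / 2].

Definition l_eps (R : realType) (Q eps : R) (N : nat) (l : R -> R)
  (i j : 'I_(N * N)) : R :=
  sup [set r | exists b b', [/\ closed_square eps i b,
                                  closed_square eps j b' &
                                  r = l (torus_dist Q b b')]].

Definition state (N : nat) := 'I_(N * N) -> nat.

Definition dep_rate (R : realType) (Q eps : R) (N : nat) (l : R -> R)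
  (N0 C L : R) (x : state N) (i : 'I_(N * N)) : R :=
  C / L * (x i)%:R *
  (ln (1 + 1 / (N0 + \sum_(j < N * N) ((x j)%:R - (j == i)%:R) * l_eps Q eps l i j))
   / ln 2).

(* rate of the move (i, true) = arrival at i, (i, false) = departure from i *)
Definition move_rate (R : realType) (Q eps : R) (N : nat) (l : R -> R)
  (N0 C L lam : R) (x : state N) (m : 'I_(N * N) * bool) : R :=
  if m.2 then lam * eps ^+ 2 else dep_rate Q eps l N0 C L x m.1.

Definition total_rate (R : realType) (Q eps : R) (N : nat) (l : R -> R)
  (N0 C L lam : R) (x : state N) : R :=
  \sum_(m : 'I_(N * N) * bool) move_rate Q eps l N0 C L lam x m.

Definition apply_move (N : nat) (x : state N) (m : 'I_(N * N) * bool) : state N :=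
  fun j => if j == m.1 then (if m.2 then (x j).+1 else (x j).-1) else x j.

(* one step of the embedded jump chain, driven by u uniform on [0,1]:
   the move m is selected with probability move_rate x m / total_rate x
   (inverse-cdf selection along the enumeration of the moves). *)
Definition jump_step (R : realType) (Q eps : R) (N : nat) (l : R -> R)
  (N0 C L lam : R) (x : state N) (u : R) : state N :=
  let s := enum {: 'I_(N * N) * bool} in
  let cum m := \sum_(m' <- take (index m s).+1 s) move_rate Q eps l N0 C L lam x m' in
  match ohead [seq m <- s | u * total_rate Q eps l N0 C L lam x < cum m] with
  | Some m => apply_move x m
  | None => x
  end.

Fixpoint jump_chain (R : realType) (Q eps : R) (N : nat) (l : R -> R)
  (N0 C L lam : R) (x0 : state N) (u : nat -> R) (k : nat) : state N :=
  match k with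
  | 0 => x0
  | k'.+1 => jump_step Q eps l N0 C L lam
               (jump_chain Q eps l N0 C L lam x0 u k') (u (2 * k').+1)
  end.

(* jump times: T_k = sum_{m<k} E_m / q(Y_m), with E_m = - ln U_{2m} ~ Exp(1) *)
Definition jump_time (R : realType) (Q eps : R) (N : nat) (l : R -> R)
  (N0 C L lam : R) (x0 : state N) (u : nat -> R) (k : nat) : R :=
  \sum_(m < k) (- ln (u (2 * m)%N)) /
     total_rate Q eps l N0 C L lam (jump_chain Q eps l N0 C L lam x0 u m).

(* the continuous-time chain X(t) = Y_k for T_k <= t < T_{k+1}
   (set to x0 after a possible explosion time, a null event) *)
Definition chain (R : realType) (Q eps : R) (N : nat) (l : R -> R)
  (N0 C L lam : R) (x0 : state N) (u : nat -> R) (t : R) : state N :=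
  jump_chain Q eps l N0 C L lam x0 u
    (xget 0%N [set k | jump_time Q eps l N0 C L lam x0 u k <= t <
                        jump_time Q eps l N0 C L lam x0 u k.+1]).

Definition iid_uniform01 (d : measure_display) (T : measurableType d)
  (R : realType) (P : probability T R) (U : nat -> T -> R) : Prop :=
  (forall k, measurable_fun setT (U k)) /\
  (forall k (A : set R), measurable A ->
     P (U k @^-1` A) = lebesgue_measure (A `&` `[0, 1]%classic)) /\
  (forall (I : seq nat) (A : nat -> set R), uniq I ->
     (forall k, measurable (A k)) ->
     P (\bigcap_(k in [set k | k \in I]) (U k @^-1` A k)) =
     (\prod_(k <- I) P (U k @^-1` A k))%E).

Definition sup_norm (R : realType) (n : nat) (v : 'I_n -> R) : R :=
  \big[Num.max/0]_(i < n) `|v i|.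

(* S(y): fluid limits started at y (only the restriction to [0,oo) matters) *)
Definition fluid_limits (R : realType) (Q eps : R) (N : nat) (l : R -> R)
  (C L lam : R) (y : 'I_(N * N) -> R) : set (R -> 'I_(N * N) -> R) :=
  [set x | x 0 = y /\
     (forall t, 0 <= t -> forall i, 0 <= x t i) /\
     exists D : 'I_(N * N) -> R -> R,
       (forall i, D i 0 = 0) /\
       (forall i s t, 0 <= s -> s <= t -> D i s <= D i t) /\
       (forall i, exists K : R, forall s t, 0 <= s -> 0 <= t ->
                  `|D i s - D i t| <= K * `|s - t|) /\
       (forall i t, 0 <= t -> x t i = y i + lam * eps ^+ 2 * t - D i t) /\
       {ae lebesgue_measure, forall t, 0 <= t ->
          (0 < sup_norm (x t) ->
             forall i, is_derive t 1 (D i)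
               (if x t i == 0 then 0 else
                  C * x t i /
                  (L * ln 2 * \sum_(k < N * N) x t k * l_eps Q eps l i k))) /\
          (sup_norm (x t) = 0 ->
             forall i, is_derive t 1 (fun r => x r i) 0)}].

(* Main.v *)
(* By discretizing the uniforms, everything that happens up to step n of the embedded chain becomes a word over a finite
   alphabet, and independence turns the probability of a word into a product.  Along such words, X_i minus its compensator
   and the n-th jump time minus the sum of the inverse total rates are martingales with bounded conditional variance;
   Chebyshev's inequality on a fixed finite grid of times of order z, together with bounded increments (resp. monotonicity)
   between grid points, shows that both are o(z) outside an event of probability O(1/z).
   Deterministically, a sequence of paths with this property has, along an ultrafilter, a limit whose cumulative departures
   D_i are Lipschitz.  At a time t > 0 with x(t) <> 0 no x_i(t) vanishes: x_i(t) = 0 forces the interference at i to vanish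
   (otherwise x_i' = lam eps^2 > 0 at a minimum of x_i), hence x_k(t) = 0 at every adjacent square k, and the tessellation
   is connected.  So the local law of large numbers gives D_i' there, while x' = 0 at almost every zero of x
   by Lebesgue's density theorem.  A contradiction argument then yields the stated convergence in probability. *)
Require Import Defs.
From HB Require Import structures.
From mathcomp Require Import all_boot all_order all_algebra.
From mathcomp Require Import all_classical all_reals all_analysis.
From mathcomp Require Import measurable_realfun.
From mathcomp Require Import ring lra.
Set Implicit Arguments. Unset Strict Implicit. Unset Printing Implicit Defensive.
Import Order.TTheory GRing.Theory Num.Theory.
Import numFieldNormedType.Exports.
Local Open Scope classical_set_scope.
Local Open Scope ring_scope.

(** * Derivatives *)

(** The fluid rate K x_i / sum_k x_k l(i,k) is homogeneous of degree 0, so in general it has no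
    continuous extension to x = 0. This rules out a Gronwall comparison with a unique solution.
    Compactness takes its place: the rates are bounded everywhere, and their convergence is used
    only where the interference is positive. Words over a finite alphabet stand in for conditional
    expectations: a martingale is a function on words whose increments have mean 0 as finite sums.
    The selection of a move takes finitely many values, so nothing is lost there. Only the holding
    times are rounded, with mesh [eta], and the rounding error is kept apart from the martingale.
    Probability enters only to show that good paths are likely; every later estimate concerns
    deterministic sequences of good paths. The deviation event is thus enclosed in a measurable bad
    event, and the existence of good paths also makes the set of fluid limits nonempty. *)

Lemma is_derive_eps (R : realType) (f : R -> R) (x l : R) :
  (forall ep, 0 < ep -> exists2 ga, 0 < ga &
     forall h, `|h| < ga -> `|f (x + h) - f x - l * h| <= ep * `|h|) ->
  is_derive x (1 : R) f l.
Proof.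
move=> H.
suff C : (fun h : R => h^-1 *: ((f \o shift x) (h *: (1 : R)) - f x)) @ 0^' --> l.
  by apply: DeriveDef; [apply/cvg_ex; exists l | apply/cvg_lim].
apply/cvgrPdist_le => ep ep0.
have [ga ga0 Hga] := H _ ep0.
near=> h.
have h0 : h != 0 by near: h; exact: nbhs_dnbhs_neq.
have hga : `|h| < ga by near: h; apply: dnbhs0_lt.
rewrite /= /GRing.scale /= mulr1 addrC [h + x]addrC.
have -> : - (h^-1 * (f (x + h) - f x)) + l = - (h^-1 * (f (x + h) - f x - l * h)).
  by field.
rewrite normrN normrM normfV ler_pdivrMl ?normr_gt0// [_ * ep]mulrC.
exact: Hga.
Unshelve. all: by end_near. Qed.

(** At a density point [t] of the zero set, every [t + h] with [h] small has a zero within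
    [th * |h|]. Otherwise the ball of radius [2 * |h|] around [t] would contain a ball of radius
    [th * |h|] free of zeros, a fraction [th / 2] of its measure, against a density above
    [1 - th / 4]. The Lipschitz bound turns such a zero into [|f (t + h)| <= L * th * |h|]. *)
Lemma is_derive0_ae_zero_set (R : realType) (f : R -> R) (L : R) :
  (forall s t, `|f s - f t| <= L * `|s - t|) ->
  {ae lebesgue_measure, forall t, f t = 0 -> is_derive t (1 : R) f 0}.
Proof.
move=> fL.
have L0 : 0 <= L.
  have := le_trans (normr_ge0 _) (fL 1 0).
  by rewrite subr0 normr1 mulr1.
pose Z := [set t | f t = 0].
have cf : continuous f.
  move=> x; apply/cvgrPdist_le => ep ep0.
  near=> t; rewrite (le_trans (fL _ _))//.
  rewrite (@le_trans _ _ ((L + 1) * `|x - t|))// ?ler_wpM2r// ?lerDl//.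
  rewrite mulrC -ler_pdivlMr; last by rewrite ltr_wpDl.
  near: t; apply: cvgr_dist_le; first exact: cvg_id.
  by rewrite divr_gt0// ltr_wpDl.
have mZ : measurable Z.
  apply: closed_measurable; rewrite (_ : Z = f @^-1` [set 0])//.
  by apply: preimage_closed => //; exact: closed_eq.
have := lebesgue_density mZ.
apply: filter_app; first exact: (ae_filter_ringOfSetsType lebesgue_measure).
apply: aeW => /= t Ht ft0.
apply: is_derive_eps => ep ep0.
(* [th <= 1] keeps the zero-free ball inside the ball of radius [2 * |h|]; the denominator [L + 1]
   allows [L = 0]. *)
pose th := Num.min 1 (ep / (L + 1)).
have th0 : 0 < th by rewrite /th lt_min ltr01 divr_gt0// ltr_wpDl.
have th1 : th <= 1 by rewrite /th ge_min lexx.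
have thL : L * th <= ep.
  apply: (@le_trans _ _ ((L + 1) * th)); first by rewrite ler_wpM2r ?lerDl// ltW.
  by rewrite mulrC -ler_pdivlMr ?ltr_wpDl// /th ge_min lexx orbT.
have tZ : t \in Z by rewrite inE.
rewrite indicE tZ /= in Ht.
have H1 : \forall r \near 0^'+,
   ((1 - th / 4)%:E < lebesgue_measure (Z `&` ball t r) * (lebesgue_measure (ball t r))^-1)%E.
  apply: (Ht [set u | ((1 - th / 4)%:E < u)%E]).
  apply: (open_nbhs_nbhs (A := [set u | ((1 - th / 4)%:E < u)%E])).
  by split; [exact: open_ereal_gt_ereal | rewrite /= lte_fin; lra].
have [ga /= ga0 Hga] := H1.
exists (ga / 2); first by rewrite divr_gt0.
move=> h hga.
have [->|h0] := eqVneq h 0; first by rewrite addr0 mulr0 !subrr normr0 mulr0.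
have nh0 : 0 < `|h| by rewrite normr_gt0.
rewrite ft0 mul0r !subr0.
pose r := 2 * `|h|.
have r0 : 0 < r by rewrite mulr_gt0.
have /= Hr := Hga r _ r0.
have {}Hr := Hr _.
suff [y [Zy yh]] : exists y, Z y /\ `|t + h - y| < th * `|h|.
  have := fL (t + h) y; rewrite Zy subr0 => /le_trans; apply.
  rewrite (@le_trans _ _ (L * (th * `|h|)))//; first by rewrite ler_wpM2l// ltW.
  by rewrite mulrA ler_wpM2r.
apply: contrapT => noy.
have : ball_ Num.Def.normr 0 ga r by rewrite /ball_ /= sub0r normrN gtr0_norm// /r; lra.
move=> /Hr {Hr}; apply/negP; rewrite -leNgt.
rewrite lebesgue_measure_ball; last exact: ltW.
rewrite inver mulrn_eq0/= gt_eqF//.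
have sub : Z `&` ball t r `<=` ball t r `\` ball (t + h) (th * `|h|).
  move=> y [Zy By]; split=> //.
  by rewrite /ball /= => Byh; apply: noy; exists y.
have sub2 : ball (t + h) (th * `|h|) `<=` ball t r.
  move=> y; rewrite /ball /= => H.
  have -> : t - y = (t + h - y) - h by ring.
  rewrite (le_lt_trans (ler_normB _ _))// /r.
  have : th * `|h| <= `|h| by rewrite ler_piMl// ltW.
  lra.
have : (lebesgue_measure (Z `&` ball t r) <= (r *+ 2 - th * `|h| *+ 2)%:E)%E.
  rewrite (@le_trans _ _ (lebesgue_measure (ball t r `\` ball (t + h) (th * `|h|))))//.
    rewrite le_measure// inE.
    - by apply: measurableI => //; exact: measurable_ball.
    - by apply: measurableD; exact: measurable_ball.
  rewrite measureD; [|exact: measurable_ball|exact: measurable_ball|].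
    have e1 := lebesgue_measure_ball t (ltW r0).
    have e2 : lebesgue_measure (ball (t + h) (th * `|h|)) = (th * `|h| *+ 2)%:E.
      by apply: lebesgue_measure_ball; rewrite mulr_ge0// ltW.
    by rewrite (setIidr sub2) EFinB -[X in (X - _ <= _)%E]/(lebesgue_measure (ball t r))
      -[X in (_ - X <= _)%E]/(lebesgue_measure (ball (t + h) (th * `|h|))) e1 e2.
  rewrite -[X in (X < _)%E]/(lebesgue_measure (ball t r)).
  by rewrite (lebesgue_measure_ball t (ltW r0)) ltry.
move=> H; rewrite (@le_trans _ _ ((r *+ 2 - th * `|h| *+ 2)%:E * (r *+ 2)^-1%:E)%E)//.
  by rewrite lee_wpmul2r// lee_fin invr_ge0 mulrn_wge0// ltW.
rewrite -EFinM lee_fin ler_pdivrMr ?mulrn_wgt0// /r.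
have p0 : 0 < th * `|h| by rewrite mulr_gt0.
have -> : (1 - th / 4) * ((2 * `|h|) *+ 2) = (2 * `|h|) *+ 2 - th * `|h| by field.
lra.
Unshelve. all: by end_near. Qed.

(** * Limits of approximate fluid paths *)

(** The image of an ultrafilter is an ultrafilter, and this one contains the compact segment
    [-M, M]. *)
Lemma ultra_lim (R : realType) (G : set_system nat) (u : nat -> R) (M : R) :
  UltraFilter G -> (\forall m \near G, `|u m| <= M) ->
  exists p : R, u @ G --> p.
Proof.
move=> GU HM; have GF : ProperFilter G by exact: ultra_proper.
have UU : UltraFilter (u @ G).
  split; first exact: fmap_proper_filter.
  move=> H HF sH; rewrite eqEsubset; split => // A HA.
  have [//|GA] := in_ultra_setVsetC (u @^-1` A) GU.
  have HA' : H (~` A) by exact: sH.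
  by have [y []] := filter_ex (filterI HA HA').
have := @segment_compact R (- M) M; rewrite compact_ultra => /(_ (u @ G) UU).
case; last by move=> p [_ Hp]; exists p.
by apply: (filterS _ HM) => m /=; rewrite in_itv /= ler_norml.
Qed.

Section FluidLimit.
Variables (R : realType) (I : finType) (w : I -> I -> R) (a K dmax : R) (x0 : I -> R).

Definition interf (x : I -> R) (i : I) : R := \sum_k x k * w i k.
Definition share (x : I -> R) (i : I) : R := K * x i / interf x i.

Hypotheses (w_ge0 : forall i k, 0 <= w i k) (w_diag : forall i, w i i = 1).
Hypothesis w_connected : forall Z : pred I, (exists i, Z i) ->
  (forall i k, Z i -> w i k = 1 -> Z k) -> forall k, Z k.
Hypotheses (a_gt0 : 0 < a) (dmax_ge0 : 0 <= dmax).

Lemma interf_ge (x : I -> R) i : (forall k, 0 <= x k) -> x i <= interf x i.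
Proof.
move=> xp; rewrite /interf (bigD1 i)//= w_diag mulr1 lerDl.
by apply: sumr_ge0 => k _; rewrite mulr_ge0.
Qed.

Variables (X D rho : nat -> I -> R -> R) (e : nat -> R).
Hypothesis e_cvg : e @ \oo --> (0 : R).
Hypothesis X_eq : forall m i t, 0 <= t <= m%:R ->
  `|X m i t - (x0 i + a * t - D m i t)| <= e m.
Hypothesis X_ge0 : forall m i t, 0 <= t <= m%:R -> 0 <= X m i t.
Hypothesis D_init : forall m i, `|D m i 0| <= e m.
Hypothesis rho_bnd : forall m i t, 0 <= t <= m%:R -> 0 <= rho m i t <= dmax.
Hypothesis D_incr : forall m i s t al be, 0 <= s -> s <= t -> t <= m%:R ->
  (forall r, s <= r <= t -> al <= rho m i r <= be) ->
  al * (t - s) - e m <= D m i t - D m i s <= be * (t - s) + e m.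
Hypothesis rho_loc : forall (x : I -> R) i, (forall k, 0 <= x k) -> 0 < interf x i ->
  forall ep, 0 < ep -> exists2 ga, 0 < ga & \forall m \near \oo,
    forall r, 0 <= r <= m%:R -> (forall k, `|X m k r - x k| < ga) ->
      `|rho m i r - share x i| <= ep.

(** The deterministic core. Path [m] is controlled on [0, m] only, up to the error [e m]. [D_incr]
    says in integrated form that [rho] is the departure rate, so no integral of [rho] has to make
    sense; [rho_loc] asks for convergence of the rate only where [share] is not singular. Closeness
    to the limit is claimed for some index beyond any [M], which is what a limit along an
    ultrafilter provides. *)
Theorem fluid_limit_exists : exists (x Dl : I -> R -> R),
  [/\ (forall i, Dl i 0 = 0) /\ (forall i t, x i t = x0 i + a * t - Dl i t),
      forall i s t, 0 <= s -> s <= t -> 0 <= Dl i t - Dl i s <= dmax * (t - s),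
      (forall i t, 0 <= t -> 0 <= x i t),
      {ae lebesgue_measure, forall t, 0 <= t ->
         ((exists i, x i t != 0) -> forall i, x i t != 0 /\
            is_derive t (1 : R) (Dl i) (share (x ^~ t) i)) /\
         ((forall i, x i t = 0) -> forall i, is_derive t (1 : R) (x i) 0)}
    & forall s de M, 0 < de -> exists m : nat, [/\ (M <= m)%N, s <= m%:R &
        forall t i, 0 <= t <= s -> `|X m i t - x i t| <= de] ].
Proof.
(* A single ultrafilter makes all the [D m i t] converge at once, without diagonal extraction. *)
have [G [GU sG]] := ultraFilterLemma eventually_filter.
have GF : ProperFilter G by exact: ultra_proper.
have near_e ep : 0 < ep -> \forall m \near G, e m < ep.
  move=> ep0; apply: sG; move/cvgrPdist_lt : e_cvg => /(_ _ ep0).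
  by apply: filterS => m; rewrite sub0r normrN; apply: le_lt_trans; exact: ler_norm.
have near_ge (t : R) : \forall m \near G, t <= m%:R.
  apply: sG; exists (Num.truncn t).+1 => // m /= tm.
  apply: ltW; apply: lt_le_trans (truncnS_gt t) _.
  by rewrite ler_nat.
have LE i t : exists p : R, 0 <= t -> (fun m => D m i t) @ G --> p.
  have [t0|t0] := leP 0 t; last by exists 0 => h; lra.
  have [p Hp] : exists p : R, (fun m => D m i t) @ G --> p.
    apply: (@ultra_lim _ _ _ (dmax * t + 2)) => //.
    near=> m.
    have tm : t <= m%:R by near: m; exact: near_ge.
    have em : e m < 1 by near: m; exact: near_e.
    have := @D_incr m i 0 t 0 dmax (lexx _) t0 tm.
    rewrite subr0 mul0r add0r => /(_ _)/andP[].
      by move=> r /andP[r0 rt]; apply: rho_bnd; rewrite r0 (le_trans rt).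
    have := D_init m i; rewrite !ler_norml => /andP[h1 h2] h3 h4.
    have d0 : 0 <= dmax * t by exact: mulr_ge0.
    by apply/andP; split; lra.
  by exists p.
have [L HL] : exists L : I -> R -> R, forall i t, 0 <= t -> (fun m => D m i t) @ G --> L i t.
  have [L HL] := choice (fun it => LE it.1 it.2).
  by exists (fun i t => L (i, t)) => i t; exact: (HL (i, t)).
(* Freezing [Dl] at its value at 0 for negative times makes it Lipschitz on the whole line, as
   [is_derive0_ae_zero_set] requires. *)
pose Dl i t := L i (Num.max t 0).
have DlE i t : 0 <= t -> Dl i t = L i t by move=> t0; rewrite /Dl max_l.
have near_D i t ep : 0 <= t -> 0 < ep -> \forall m \near G, `|D m i t - Dl i t| < ep.
  move=> t0 ep0; have := HL i t t0; move/cvgrPdist_lt => /(_ _ ep0).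
  by apply: filterS => m; rewrite DlE// distrC.
pose x i t := x0 i + a * t - Dl i t.
(* Bounds on the rate that hold along [G] pass to the increments of the limit because [e m]
   vanishes. *)
have inc_loc i s t al be : 0 <= s -> s <= t ->
    (\forall m \near G, forall r, s <= r <= t -> al <= rho m i r <= be) ->
    al * (t - s) <= Dl i t - Dl i s <= be * (t - s).
  move=> s0 st Hr.
  have F ep : 0 < ep -> exists m, [/\ forall r, s <= r <= t -> al <= rho m i r <= be,
      t <= m%:R, e m < ep, `|D m i t - Dl i t| < ep & `|D m i s - Dl i s| < ep].
    move=> ep0; apply: (@filter_ex _ G).
    near=> m; split; near: m; [exact: Hr|exact: near_ge|exact: near_e| |exact: near_D].
    by apply: near_D => //; exact: le_trans st.
  apply/andP; split; apply/ler_addgt0Pr => ep ep0.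
    have ep30 : 0 < ep / 3 by rewrite divr_gt0.
    have [m [h1 h2 h3]] := F _ ep30.
    rewrite !ltr_norml => /andP[h4 h5] /andP[h6 h7].
    have /andP[h8 h9] := @D_incr m i s t al be s0 st h2 h1.
    lra.
  have ep30 : 0 < ep / 3 by rewrite divr_gt0.
  have [m [h1 h2 h3]] := F _ ep30.
  rewrite !ltr_norml => /andP[h4 h5] /andP[h6 h7].
  have /andP[h8 h9] := @D_incr m i s t al be s0 st h2 h1.
  lra.
have near_rho i t : \forall m \near G, forall r, 0 <= r <= t -> 0 <= rho m i r <= dmax.
  near=> m => r /andP[r0 rt]; apply: rho_bnd; rewrite r0 (le_trans rt)//.
  by near: m; exact: near_ge.
have inc i s t : 0 <= s -> s <= t -> 0 <= Dl i t - Dl i s <= dmax * (t - s).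
  move=> s0 st; have := @inc_loc i s t 0 dmax s0 st; rewrite mul0r; apply.
  near=> m => r /andP[rs rt].
  have : forall r, 0 <= r <= t -> 0 <= rho m i r <= dmax by near: m; exact: near_rho.
  by apply; rewrite rt (le_trans s0).
(* Between points of a grid of mesh [h], both functions grow by at most [dmax * h], up to [e m]; so
   convergence at finitely many grid points is uniform convergence. *)
have unifD s de : 0 < de -> \forall m \near G, forall i t, 0 <= t <= s -> `|D m i t - Dl i t| <= de.
  move=> de0.
  pose h := de / (4 * (dmax + 1)).
  have d10 : 0 < 4 * (dmax + 1) by rewrite mulr_gt0// ltr_wpDl.
  have h0 : 0 < h by rewrite divr_gt0.
  have hd : dmax * h <= de / 4.
    have -> : de / 4 = (dmax + 1) * h.
      by rewrite /h; field; rewrite gt_eqF// ltr_wpDl.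
    by rewrite ler_wpM2r// ?ltW// ltrDl.
  have de40 : 0 < de / 4 by rewrite divr_gt0.
  pose J := (Num.truncn (s / h)).+1.
  near=> m => i t /andP[t0 ts].
  have sm : s <= m%:R by near: m; exact: near_ge.
  have em : e m < de / 4 by near: m; exact: near_e.
  have Hg : forall (j : 'I_J) (i : I), `|D m i (j%:R * h) - Dl i (j%:R * h)| < de / 4.
    near: m; apply: filter_forall => j; apply: filter_forall => i'.
    by apply: near_D => //; rewrite mulr_ge0// ltW.
  have jJ : (Num.truncn (t / h) < J)%N by rewrite ltnS le_truncn// ler_pM2r// invr_gt0.
  pose j := Ordinal jJ.
  have jt : j%:R * h <= t < j%:R * h + h.
    rewrite -ler_pdivlMr// truncn_le divr_ge0 ?(ltW h0)//=.
    have := truncnS_gt (t / h); rewrite ltr_pdivrMr// -natr1 mulrDl mul1r.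
    by move=> ->.
  have /andP[jt1 jt2] := jt.
  have jh0 : 0 <= j%:R * h by rewrite mulr_ge0// ltW.
  have := Hg j i; rewrite ltr_norml => /andP[g1 g2].
  have /andP[i1 i2] := inc i _ _ jh0 jt1.
  have := @D_incr m i (j%:R * h) t 0 dmax jh0 jt1 (le_trans ts sm).
  rewrite mul0r sub0r => /(_ _)/andP[|d1 d2].
    by move=> r /andP[rj rt]; apply: rho_bnd; rewrite (le_trans jh0 rj)/= (le_trans rt (le_trans ts sm)).
  have dh : dmax * (t - j%:R * h) <= dmax * h by rewrite ler_wpM2l// lerBlDl ltW.
  by rewrite ler_norml; apply/andP; split; lra.
have unifX s de : 0 < de -> \forall m \near G, forall i t, 0 <= t <= s -> `|X m i t - x i t| <= de.
  move=> de0; have de20 : 0 < de / 2 by rewrite divr_gt0.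
  near=> m => i t /andP[t0 ts].
  have sm : s <= m%:R by near: m; exact: near_ge.
  have em : e m < de / 2 by near: m; exact: near_e.
  have : forall i t, 0 <= t <= s -> `|D m i t - Dl i t| <= de / 2 by near: m; exact: unifD.
  move=> /(_ i t); rewrite t0 ts => /(_ isT).
  have := @X_eq m i t; rewrite t0 (le_trans ts sm) => /(_ isT).
  rewrite /x !ler_norml => /andP[? ?] /andP[? ?].
  by apply/andP; split; lra.
have x_ge0 i t : 0 <= t -> 0 <= x i t.
  move=> t0; apply/ler_addgt0Pr => ep ep0.
  have [m [h1 h2]] : exists m, `|X m i t - x i t| <= ep /\ t <= m%:R.
    apply: (@filter_ex _ G); near=> m; split; near: m; last exact: near_ge.
    by apply: filterS (unifX t ep ep0) => m; apply; rewrite t0 lexx.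
  have := @X_ge0 m i t; rewrite t0 h2 => /(_ isT).
  by move: h1; rewrite ler_norml => /andP[? ?] ?; lra.
have Dl_lip i s t : `|Dl i s - Dl i t| <= dmax * `|s - t|.
  wlog st : s t / s <= t.
    by move=> W; have [/W //|/ltW/W] := leP s t; rewrite distrC [`|t - s|]distrC.
  rewrite [`|Dl _ _ - _|]distrC [`|s - t|]distrC [`|t - s|]ger0_norm ?subr_ge0//.
  have s0 : 0 <= Num.max s 0 by rewrite le_max lexx orbT.
  have st' : Num.max s 0 <= Num.max t 0.
    by rewrite ge_max !le_max st lexx orbT.
  have /andP[] := @inc i _ _ s0 st'.
  have -> : Dl i (Num.max t 0) = Dl i t by rewrite /Dl -maxA maxxx.
  have -> : Dl i (Num.max s 0) = Dl i s by rewrite /Dl -maxA maxxx.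
  move=> h1 h2; rewrite ger0_norm// (le_trans h2)// ler_wpM2l//.
  by rewrite /Num.max; case: ltP => ?; case: ltP => ?; lra.
have x_lip i s t : `|x i s - x i t| <= (a + dmax) * `|s - t|.
  have -> : x i s - x i t = a * (s - t) - (Dl i s - Dl i t) by rewrite /x; ring.
  rewrite (le_trans (ler_normB _ _))// mulrDl lerD// normrM gtr0_norm//.
have deriv i t : 0 < t -> 0 < interf (x ^~ t) i -> forall ep, 0 < ep ->
    exists2 ga, 0 < ga & forall h, `|h| < ga ->
      `|Dl i (t + h) - Dl i t - share (x ^~ t) i * h| <= ep * `|h|.
  move=> t0 it ep ep0.
  have [ga ga0 Hga] := rho_loc (fun k => x_ge0 k t (ltW t0)) it ep0.
  have ad0 : 0 < a + dmax by rewrite ltr_wpDr.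
  (* On the window of half-width [g1] the limit moves by at most [ga / 4] and the path stays within
     [ga / 4] of it, so [rho_loc] applies on the whole window. [g1 <= t] keeps the window at
     nonnegative times. *)
  pose g1 := Num.min t (ga / (4 * (a + dmax))).
  have g10 : 0 < g1 by rewrite lt_min t0 divr_gt0// mulr_gt0.
  have g1t : g1 <= t by rewrite ge_min lexx.
  have g1g : (a + dmax) * g1 <= ga / 4.
    rewrite mulrC -ler_pdivlMr// (_ : ga / 4 / _ = ga / (4 * (a + dmax))).
      by rewrite ge_min lexx orbT.
    by field; rewrite gt_eqF.
  have Hr : \forall m \near G, forall r, `|r - t| <= g1 ->
      share (x ^~ t) i - ep <= rho m i r <= share (x ^~ t) i + ep.
    near=> m => r rt.
    have tm : t + t <= m%:R by near: m; exact: near_ge.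
    have : forall i s, 0 <= s <= t + t -> `|X m i s - x i s| <= ga / 4.
      by near: m; apply: unifX; rewrite divr_gt0.
    have : forall r, 0 <= r <= m%:R -> (forall k, `|X m k r - x k t| < ga) ->
      `|rho m i r - share (x ^~ t) i| <= ep by near: m; exact: (sG _ Hga).
    have r0t : 0 <= r <= t + t.
      by move: rt; rewrite ler_norml => /andP[? ?]; apply/andP; split; lra.
    have /andP[r0 rtt] := r0t.
    move=> /(_ r); rewrite r0 (le_trans rtt tm) => /(_ isT) H1 H2.
    have : `|rho m i r - share (x ^~ t) i| <= ep.
      apply: H1 => k.
      have -> : X m k r - x k t = (X m k r - x k r) + (x k r - x k t) by ring.
      rewrite (le_lt_trans (ler_normD _ _))//.
      rewrite (@le_lt_trans _ _ (ga / 4 + (a + dmax) * `|r - t|))//.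
        by rewrite lerD// H2.
      have : (a + dmax) * `|r - t| <= (a + dmax) * g1 by rewrite ler_wpM2l// ltW.
      lra.
    by rewrite ler_norml => /andP[? ?]; apply/andP; split; lra.
  have Hr' s1 s2 : t - g1 <= s1 -> s2 <= t + g1 -> \forall m \near G, forall r,
      s1 <= r <= s2 -> share (x ^~ t) i - ep <= rho m i r <= share (x ^~ t) i + ep.
    move=> h1 h2; apply: filterS Hr => m H r /andP[r1 r2]; apply: H.
    by rewrite ler_norml; apply/andP; split; lra.
  exists g1 => // h hg.
  have [h0|h0] := leP 0 h.
    have th : t <= t + h by rewrite lerDl.
    have h1 : t - g1 <= t by lra.
    have h2 : t + h <= t + g1 by move: hg; rewrite ger0_norm// => hg; lra.
    have := inc_loc i _ _ _ _ (ltW t0) th (Hr' _ _ h1 h2).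
    rewrite (_ : t + h - t = h); last by ring.
    by move=> /andP[? ?]; rewrite (ger0_norm h0) ler_norml; apply/andP; split; lra.
  have th : t + h <= t by rewrite gerDl ltW.
  have h1 : t - g1 <= t + h by move: hg; rewrite ltr0_norm// => hg; lra.
  have h2 : t <= t + g1 by lra.
  have th0 : 0 <= t + h by lra.
  have := inc_loc i _ _ _ _ th0 th (Hr' _ _ h1 h2).
  rewrite (_ : t - (t + h) = - h); last by ring.
  by move=> /andP[? ?]; rewrite (ltr0_norm h0) ler_norml; apply/andP; split; lra.
have interf0 i t : 0 < t -> x i t = 0 -> interf (x ^~ t) i = 0.
  move=> t0 xt0; apply/eqP; rewrite eq_le; apply/andP; split; last first.
    by rewrite -xt0; apply: interf_ge => k; apply: x_ge0; exact: ltW.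
  rewrite leNgt; apply/negP => it.
  have a20 : 0 < a / 2 by rewrite divr_gt0.
  have [ga ga0 Hga] := deriv i t t0 it _ a20.
  (* The contradiction is found backwards in time: [share] is 0 at [t], so [Dl i] changes by at most
     [a / 2 * h] on [t - h, t], while arrivals bring [a * h]. Hence [x i (t - h)] would be
     negative. *)
  pose h := Num.min t (ga / 2).
  have h0 : 0 < h by rewrite lt_min t0 divr_gt0.
  have hga : h < ga.
    by rewrite gt_min; apply/orP; right; lra.
  have ht : h <= t by rewrite ge_min lexx.
  have := Hga (- h); rewrite normrN gtr0_norm// => /(_ hga).
  rewrite /share xt0 mulr0 mul0r mul0r subr0 ler_norml => /andP[h1 h2].
  have := x_ge0 i (t - h); rewrite subr_ge0 => /(_ ht).
  have ah : 0 < a * h by rewrite mulr_gt0.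
  move: xt0; rewrite /x => xt0; lra.
have pos t : 0 < t -> (exists i, x i t != 0) -> forall i, x i t != 0.
  move=> t0 [k xk] i; apply/negP => xi0.
  move/negP : xk; apply.
  apply: (w_connected (Z := fun i => x i t == 0)); first by exists i.
  move=> j l /eqP xj wjl.
  have /eqP := interf0 _ _ t0 xj; rewrite /interf psumr_eq0.
    by move=> /allP/(_ l); rewrite mem_index_enum wjl mulr1 => /(_ isT).
  by move=> k' _; rewrite mulr_ge0// x_ge0// ltW.
exists x, Dl; split => //.
- split => // i; apply/eqP; rewrite -normr_le0; apply/ler_addgt0Pr => ep ep0.
  have ep20 : 0 < ep / 2 by rewrite divr_gt0.
  have [m [h1 h2]] : exists m, `|D m i 0 - Dl i 0| < ep / 2 /\ e m < ep / 2.
    by apply: (@filter_ex _ G); near=> m; split; near: m; [exact: near_D|exact: near_e].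
  have := D_init m i.
  have -> : Dl i 0 = D m i 0 - (D m i 0 - Dl i 0) by ring.
  by have := ler_normB (D m i 0) (D m i 0 - Dl i 0); lra.
- have Hz : {ae lebesgue_measure, forall t, forall i, x i t = 0 -> is_derive t (1 : R) (x i) 0}.
    apply: filter_forall => i.
    by apply: (@is_derive0_ae_zero_set _ _ (a + dmax)) => s t; exact: x_lip.
  (* Time 0 is discarded, as the derivative estimate looks at both sides of [t]. *)
  have H0 : {ae lebesgue_measure, forall t : R, t != 0}.
    exists [set 0]; split=> //; first exact: lebesgue_measure_set1.
    by move=> t /= /negP; rewrite negbK => /eqP.
  have F := ae_filter_ringOfSetsType (@lebesgue_measure R).
  apply: filterS2 Hz H0 => t Ht t0 tge0.
  have {t0}tgt0 : 0 < t by rewrite lt_neqAle eq_sym t0.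
  split=> [xn0 i|x00 i]; last by apply: Ht.
  have xi0 := pos _ tgt0 xn0 i; split => //.
  apply: is_derive_eps; apply: deriv => //.
  apply: lt_le_trans (interf_ge _ _); last by move=> k; apply: x_ge0; exact: ltW.
  by rewrite lt_neqAle eq_sym xi0 x_ge0// ltW.
- move=> s de M de0; apply: (@filter_ex _ G); near=> m; split; near: m.
  + by apply: sG; exists M.
  + exact: near_ge.
  + by apply: filterS (unifX s de de0) => m H t i; exact: H.
Unshelve. all: by end_near. Qed.
End FluidLimit.

(** * Interference between squares *)

Section PathLoss.
Variables (R : realType) (Q eps : R) (N : nat) (l : R -> R).
Hypotheses (eps_gt0 : 0 < eps).
Hypothesis l_ge0 : forall r, 0 <= r -> 0 <= l r.
Hypothesis l_noninc : forall r s, 0 <= r -> r <= s -> l s <= l r.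
Hypothesis l0 : l 0 = 1.

Let w := @l_eps R Q eps N l.

Lemma torus_dist_xx b : torus_dist Q b b = 0.
Proof.
rewrite /torus_dist !subrr.
have -> : circ_dist Q 0 = 0.
  apply/eqP; rewrite eq_le; apply/andP; split.
    apply: ge_inf; first by exists 0 => _ [m _ <-].
    by exists 0 => //; rewrite mulr0 subr0 normr0.
  by apply: lb_le_inf; [exists `|0 - 2 * Q * 0|, 0 | move=> _ [m _ <-]].
by rewrite expr0n/= addr0 sqrtr0.
Qed.

Let lset (i j : 'I_(N * N)) := [set r | exists b b', [/\ closed_square eps i b,
  closed_square eps j b' & r = l (torus_dist Q b b')]].

Lemma center_in_square (i : 'I_(N * N)) : closed_square eps i (Defs.center eps i).
Proof. by split; rewrite subrr normr0 divr_ge0// ltW. Qed.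

Let lset_ub i j : ubound (lset i j) 1.
Proof. by move=> _ [b [b' [_ _ ->]]]; rewrite -l0 l_noninc// sqrtr_ge0. Qed.

Let lset_n0 i j : lset i j (l (torus_dist Q (Defs.center eps i) (Defs.center eps j))).
Proof. by exists (Defs.center eps i), (Defs.center eps j); split => //; exact: center_in_square. Qed.

Lemma l_eps_ge0 i j : 0 <= w i j.
Proof.
apply: (@le_trans _ _ (l (torus_dist Q (Defs.center eps i) (Defs.center eps j)))).
  by apply: l_ge0; exact: sqrtr_ge0.
by apply: ub_le_sup; [exists 1; exact: lset_ub | exact: lset_n0].
Qed.

Lemma l_eps_le1 i j : w i j <= 1.
Proof. by apply: ge_sup; [eexists; exact: lset_n0 | exact: lset_ub]. Qed.

(** The supremum runs over closed squares, so a common boundary point already realises distance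
    0. *)
Lemma l_eps_meet i j b : closed_square eps i b -> closed_square eps j b -> w i j = 1.
Proof.
move=> bi bj; apply/eqP; rewrite eq_le l_eps_le1/=.
apply: ub_le_sup; first by exists 1; exact: lset_ub.
by exists b, b; rewrite torus_dist_xx l0.
Qed.

(** The midpoint of the two centers lies in both closed squares; diagonal neighbours are
    included. *)
Lemma l_eps_adjacent (i j : 'I_(N * N)) :
  `|((i %/ N)%N)%:R - ((j %/ N)%N)%:R| <= 1 :> R ->
  `|((i %% N)%N)%:R - ((j %% N)%N)%:R| <= 1 :> R -> w i j = 1.
Proof.
have H (x y : R) : `|x - y| <= 1 ->
    `|(x * eps + y * eps) / 2 - x * eps| <= eps / 2 /\
    `|(x * eps + y * eps) / 2 - y * eps| <= eps / 2.
  move=> xy.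
  have -> : (x * eps + y * eps) / 2 - x * eps = - ((x - y) * (eps / 2)) by field.
  have -> : (x * eps + y * eps) / 2 - y * eps = (x - y) * (eps / 2) by field.
  by rewrite normrN normrM (ger0_norm (_ : 0 <= eps / 2)) ?divr_ge0 ?(ltW eps_gt0)//
     ler_piMl// divr_ge0// ltW.
move=> /H[a1 a2] /H[b1 b2].
apply: (@l_eps_meet i j (((Defs.center eps i).1 + (Defs.center eps j).1) / 2,
   ((Defs.center eps i).2 + (Defs.center eps j).2) / 2)); by split.
Qed.

Lemma l_eps_diag i : w i i = 1.
Proof. by apply: l_eps_adjacent; rewrite subrr normr0. Qed.

(* The king's move (r, c) -> (r - 1, c - 1), truncated at 0, leads from every square to the square 0. *)
Lemma l_eps_connected (Z : pred 'I_(N * N)) : (exists i, Z i) ->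
  (forall i k, Z i -> w i k = 1 -> Z k) -> forall k, Z k.
Proof.
move=> [i0 Zi0] HZ k.
have dist1 (u v : nat) : (v = u.-1) -> `|u%:R - v%:R| <= 1 :> R /\ `|v%:R - u%:R| <= 1 :> R.
  move=> ->; rewrite [X in _ /\ X <= _]distrC; suff: `|u%:R - u.-1%:R| <= 1 :> R by [].
  case: u => [|u] /=; first by rewrite subrr normr0.
  by rewrite -natr1 [_ + 1]addrC addrK normr1.
have N0 : (0 < N)%N by case: (N) (k) => [|//] [].
(* The equivalence serves twice: [Z] is carried from [i0] down to square 0, and from there back up
   to [k]. *)
have main n : forall (i j : 'I_(N * N)), val j = ((i %/ N - n) * N + (i %% N - n))%N ->
    Z i <-> Z j.
  elim: n => [|n IH] i j.
    by rewrite !subn0 -divn_eq => /val_inj ->.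
  move=> jE.
  pose v := ((i %/ N - n) * N + (i %% N - n))%N.
  have mN : (i %% N < N)%N by rewrite ltn_mod.
  have vN : (v < N * N)%N.
    apply: leq_ltn_trans (ltn_ord i); rewrite /v {3}(divn_eq i N).
    by rewrite leq_add ?leq_mul ?leq_subr.
  rewrite (IH i (Ordinal vN) erefl).
  have mN' : (i %% N - n < N)%N by rewrite (leq_ltn_trans (leq_subr _ _)).
  have v1 : (v %/ N = i %/ N - n)%N by rewrite /v divnMDl// (divn_small mN') addn0.
  have v2 : (v %% N = i %% N - n)%N by rewrite /v modnMDl (modn_small mN').
  have nN : (i %% N - n.+1 < N)%N by rewrite (leq_ltn_trans (leq_subr _ _)).
  have j1 : (j %/ N = (v %/ N).-1)%N.
    by rewrite jE divnMDl// (divn_small nN) addn0 v1 subnS.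
  have j2 : (j %% N = (v %% N).-1)%N.
    by rewrite jE modnMDl (modn_small nN) v2 subnS.
  have [a1 a2] := dist1 _ _ j1; have [b1 b2] := dist1 _ _ j2.
  by split=> [Zi|Zj]; [apply: (HZ _ _ Zi) | apply: (HZ _ _ Zj)]; apply: l_eps_adjacent.
have NN : (0 < N * N)%N by rewrite muln_gt0 N0.
have to0 (i : 'I_(N * N)) : val (Ordinal NN) = ((i %/ N - N) * N + (i %% N - N))%N.
  have : (i %/ N < N)%N by rewrite ltn_divLR.
  have : (i %% N < N)%N by rewrite ltn_mod.
  by move=> /ltnW; rewrite -subn_eq0 => /eqP -> /ltnW; rewrite -subn_eq0 => /eqP ->.
by rewrite (main N k _ (to0 k)) -(main N i0 _ (to0 i0)).
Qed.
End PathLoss.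

(** * Transition rates *)

(** Both sides come from [ln (1 + v) <= v], applied to [1 / d] and, after inversion, to
    [- 1 / (1 + d)]. The two bounds have the same limit after scaling, which makes the logarithmic
    rate a quotient. *)
Lemma ln1DV_bounds (R : realType) (d : R) : 0 < d ->
  1 / (1 + d) <= ln (1 + 1 / d) <= 1 / d.
Proof.
move=> d0; apply/andP; split; last first.
  apply: le_ln1Dx; rewrite (@lt_trans _ _ 0)// ?divr_gt0//; lra.
have d1 : 0 < 1 + d by lra.
have -> : 1 + 1 / d = (1 + - (1 / (1 + d)))^-1.
  by field; rewrite !gt_eqF//; lra.
have p : 0 < 1 + - (1 / (1 + d)).
  have -> : 1 + - (1 / (1 + d)) = d / (1 + d) by field; rewrite gt_eqF.
  by rewrite divr_gt0.
rewrite lnV ?posrE// lerNr; apply: le_ln1Dx; lra.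
Qed.

Lemma quotient_cont (R : realType) (x S ep : R) : 0 < S -> 0 < ep ->
  exists2 ga, 0 < ga & forall y s, `|y - x| <= ga -> `|s - S| <= ga ->
    0 < s /\ `|y / s - x / S| <= ep.
Proof.
move=> S0 ep0.
have c0 : 0 < S + `|x| by rewrite ltr_pwDl.
pose ga := Num.min (S / 2) (ep * S ^+ 2 / (2 * (S + `|x|))).
exists ga; first by rewrite lt_min !divr_gt0// ?mulr_gt0// exprn_gt0.
have g1 : ga <= S / 2 by rewrite ge_min lexx.
have g2 : ga * (S + `|x|) <= ep * S ^+ 2 / 2.
  rewrite -ler_pdivlMr// (_ : _ / 2 / _ = ep * S ^+ 2 / (2 * (S + `|x|))).
    by rewrite ge_min lexx orbT.
  by field; rewrite gt_eqF.
move=> y s yx sS.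
have s2 : S / 2 <= s by move: sS; rewrite ler_norml => /andP[? ?]; lra.
have s0 : 0 < s by rewrite (lt_le_trans _ s2)// divr_gt0.
split => //.
have -> : y / s - x / S = ((y - x) * S - x * (s - S)) / (s * S).
  by field; rewrite !gt_eqF.
rewrite normrM normfV [`|s * S|]gtr0_norm ?mulr_gt0// ler_pdivrMr ?mulr_gt0//.
rewrite (le_trans (ler_normB _ _))// !normrM (gtr0_norm S0).
have h1 : `|y - x| * S <= ga * S by rewrite ler_pM2r.
have h2 : `|x| * `|s - S| <= `|x| * ga by rewrite ler_wpM2l.
have h3 : ep * S * (S / 2) <= ep * S * s by rewrite ler_wpM2l// ltW// mulr_gt0.
rewrite mulrCA [s * _]mulrC.
have e1 : ep * S ^+ 2 / 2 = ep * S * (S / 2) by field.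
rewrite e1 in g2.
have e2 : ep * (S * s) = ep * S * s by ring.
have e3 : S * (ep * s) = ep * S * s by ring.
rewrite ?e2 ?e3; lra.
Qed.

Section Rates.
Variables (R : realType) (Q eps : R) (N : nat) (l : R -> R) (N0 C L lam : R).
Hypotheses (eps_gt0 : 0 < eps) (N_gt0 : (0 < N)%N).
Hypotheses (N0_gt0 : 0 < N0) (C_gt0 : 0 < C) (L_gt0 : 0 < L) (lam_gt0 : 0 < lam).

Let w := @l_eps R Q eps N l.
Hypotheses (w_ge0 : forall i j, 0 <= w i j) (w_diag : forall i, w i i = 1).
Hypothesis w_le1 : forall i j, w i j <= 1.

Definition unit_rate : R := C / (L * ln 2).
(** With S the interference at an occupied square, x_i <= S and S >= 1, and S / (N0 + S - 1) never
    exceeds the larger of 1 and 1 / N0. *)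
Definition max_dep : R := unit_rate * (1 + 1 / N0).

Local Notation dep := (@dep_rate R Q eps N l N0 C L).
Local Notation total := (@total_rate R Q eps N l N0 C L lam).

Lemma ln2_gt0 : 0 < ln (2 : R).
Proof. by rewrite ln_gt0// ltr1n. Qed.

Lemma unit_rate_gt0 : 0 < unit_rate.
Proof. by rewrite /unit_rate divr_gt0// mulr_gt0// ln2_gt0. Qed.

Lemma max_dep_ge0 : 0 <= max_dep.
Proof. by rewrite /max_dep mulr_ge0 ?(ltW unit_rate_gt0)// addr_ge0// divr_ge0// ltW. Qed.

(** The customer in service is removed from the interference with weight [w i i = 1], whence the
    [- 1]. *)
Lemma dep_rateE (x : state N) i :
  dep x i = unit_rate * (x i)%:R * ln (1 + 1 / (N0 + interf w (fun k => (x k)%:R) i - 1)).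
Proof.
have -> : N0 + interf w (fun k => (x k)%:R) i - 1 =
    N0 + \sum_(j < N * N) ((x j)%:R - (j == i)%:R) * w i j.
  rewrite -addrA; congr (_ + _); rewrite /interf.
  under [RHS]eq_bigr do rewrite mulrBl.
  rewrite sumrB; congr (_ - _).
  rewrite (bigD1 i)//= eqxx mul1r w_diag big1 ?addr0// => j /negbTE ->.
  by rewrite mul0r.
rewrite /dep_rate /unit_rate; field.
by rewrite !gt_eqF// ln2_gt0.
Qed.

Lemma dep_rate_bnd (x : state N) i : 0 <= dep x i <= max_dep.
Proof.
rewrite dep_rateE; set S := interf _ _ _.
case: (posnP (x i)) => [->|xi]; first by rewrite mulr0 mul0r lexx max_dep_ge0.
have xS : (x i)%:R <= S.
  by apply: (interf_ge w_ge0 w_diag) => k; exact: ler0n.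
have xi1 : 1 <= (x i)%:R :> R by rewrite ler1n.
have S1 : 1 <= S by apply: le_trans xS.
have n0 : 0 < N0 by exact: N0_gt0.
have d0 : 0 < N0 + S - 1 by lra.
have /andP[h1 h2] := ln1DV_bounds d0.
have u0 := unit_rate_gt0.
apply/andP; split.
  apply: mulr_ge0; first by rewrite mulr_ge0// ltW.
  by apply: le_trans h1; rewrite divr_ge0// addr_ge0// ltW.
rewrite -mulrA ler_pM2l//.
apply: (@le_trans _ _ ((x i)%:R * (1 / (N0 + S - 1)))).
  by rewrite ler_wpM2l.
rewrite mulrA mulr1 ler_pdivrMr//.
have -> : (1 + 1 / N0) * (N0 + S - 1) = N0 + S - 1 + 1 + (S - 1) / N0.
  by field; rewrite gt_eqF.
have : 0 <= (S - 1) / N0 by rewrite divr_ge0 ?(ltW N0_gt0)// subr_ge0.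
lra.
Qed.

Lemma dep_rate0 (x : state N) i : x i = 0%N -> dep x i = 0.
Proof. by move=> xi; rewrite dep_rateE xi mulr0 mul0r. Qed.

(** By [ln1DV_bounds] the rate lies between [unit_rate] times the quotients of [y i] by
    [(d + 1) / z] and by [d / z], where [y] is the scaled state. Both denominators are close to the
    interference of [x], so [quotient_cont] applies to each. *)
Lemma dep_rate_loc (x : 'I_(N * N) -> R) i : 0 < interf w x i ->
  forall ep, 0 < ep -> exists2 ga, 0 < ga & exists z0 : nat, forall (z : nat) (Y : state N),
    (z0 <= z)%N -> (0 < z)%N -> (forall k, `|(Y k)%:R / z%:R - x k| < ga) ->
    `|dep Y i - share w unit_rate x i| <= ep.
Proof.
move=> S0 ep ep0; set S := interf w x i in S0.
have u0 := unit_rate_gt0.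
have [g g0 Hg] := @quotient_cont R (x i) S (ep / unit_rate) S0 (divr_gt0 ep0 u0).
pose n : R := (N * N)%:R.
(* The [n] coordinates together shift the interference by at most [g / 2]; the other half of [g]
   absorbs the constants [N0 - 1] and [N0] divided by [z], which sets the threshold on [z]. *)
pose ga := g / (2 * (n + 1)).
have n1 : 0 < 2 * (n + 1) by rewrite mulr_gt0// ltr_wpDl.
have ga0 : 0 < ga by rewrite divr_gt0.
have gan : n * ga <= g / 2.
  have -> : g / 2 = (n + 1) * ga by rewrite /ga; field; rewrite gt_eqF// ltr_wpDl.
  by rewrite ler_wpM2r ?ltW// ltrDl.
have gag : ga <= g.
  have n0 : 0 <= n by exact: ler0n.
  by rewrite /ga ler_pdivrMr// ler_peMr ?(ltW g0)//; lra.
exists ga => //.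
exists (Num.truncn (2 * (`|N0 - 1| + 1) / g)).+1 => z Y zz z0 HY.
have zR : 0 < z%:R :> R by rewrite ltr0n.
have zg : (`|N0 - 1| + 1) / z%:R <= g / 2.
  rewrite ler_pdivrMr// mulrC -ler_pdivrMr ?divr_gt0//.
  have -> : (`|N0 - 1| + 1) / (g / 2) = 2 * (`|N0 - 1| + 1) / g.
    by field; rewrite gt_eqF.
  by rewrite ltW// (lt_le_trans (truncnS_gt _))// ler_nat.
pose y k : R := (Y k)%:R / z%:R.
have Sy : `|interf w y i - S| <= g / 2.
  rewrite /S /interf -sumrB (le_trans (ler_norm_sum _ _ _))//.
  apply: le_trans gan; rewrite /n -[X in _ <= X%:R * _]card_ord mulr_natl -sumr_const.
  apply: ler_sum => k _; rewrite -mulrBl normrM (ger0_norm (w_ge0 _ _)).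
  by rewrite (le_trans _ (ltW (HY k)))// ler_piMr.
rewrite dep_rateE; set SY := interf w (fun k => (Y k)%:R) i.
have SYE : SY = z%:R * interf w y i.
  rewrite /SY /interf mulr_sumr; apply: eq_bigr => k _.
  by rewrite /y; field; rewrite gt_eqF.
set d := N0 + SY - 1.
have dz c : `|c| <= 1 -> `|(d + c) / z%:R - S| <= g.
  move=> c1.
  have -> : (d + c) / z%:R - S = (N0 - 1 + c) / z%:R + (interf w y i - S).
    by rewrite /d SYE; field; rewrite gt_eqF.
  rewrite (le_trans (ler_normD _ _))// [g]splitr lerD//.
  rewrite normrM normfV (gtr0_norm zR); apply: le_trans zg.
  rewrite ler_pM2r ?invr_gt0// (le_trans (ler_normD _ _))// lerD2l//.
have yx : `|y i - x i| <= g by exact: le_trans (ltW (HY i)) gag.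
have [d0 q0] : 0 < d / z%:R /\ `|y i / (d / z%:R) - x i / S| <= ep / unit_rate.
  by apply: Hg => //; have := dz 0; rewrite addr0 normr0 => ->.
have [d1 q1] : 0 < (d + 1) / z%:R /\ `|y i / ((d + 1) / z%:R) - x i / S| <= ep / unit_rate.
  by apply: Hg => //; apply: dz; rewrite normr1.
have dp : 0 < d by move: d0; rewrite pmulr_lgt0 ?invr_gt0.
have /andP[h1 h2] := ln1DV_bounds dp.
have -> : unit_rate * (Y i)%:R * ln (1 + 1 / d) - share w unit_rate x i =
    ((Y i)%:R * ln (1 + 1 / d) - x i / S) * unit_rate.
  by rewrite /share -/S; field; rewrite gt_eqF.
rewrite normrM (gtr0_norm u0) -ler_pdivlMr//.
move: q0 q1; rewrite !ler_norml => /andP[q1 q2] /andP[q3 q4].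
have Yn : 0 <= (Y i)%:R :> R by exact: ler0n.
have e0 : y i / (d / z%:R) = (Y i)%:R * (1 / d) by rewrite /y; field; rewrite !gt_eqF.
have e1 : y i / ((d + 1) / z%:R) = (Y i)%:R * (1 / (1 + d)).
  by rewrite /y; field; rewrite !gt_eqF//; lra.
have g1 : (Y i)%:R * ln (1 + 1 / d) <= (Y i)%:R * (1 / d) by rewrite ler_wpM2l.
have g2 : (Y i)%:R * (1 / (1 + d)) <= (Y i)%:R * ln (1 + 1 / d) by rewrite ler_wpM2l.
rewrite e0 in q2; rewrite e1 in q3.
by apply/andP; split; lra.
Qed.

Definition arr_rate : R := lam * eps ^+ 2.
Definition max_total : R := (N * N)%:R * (arr_rate + max_dep).

Lemma arr_rate_gt0 : 0 < arr_rate.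
Proof. by rewrite /arr_rate mulr_gt0// exprn_gt0. Qed.

Lemma move_rate_ge0 (x : state N) m : 0 <= move_rate Q eps l N0 C L lam x m.
Proof.
by rewrite /move_rate; case: ifP => _; [exact/ltW/arr_rate_gt0|case/andP: (dep_rate_bnd x m.1)].
Qed.

(** The bounds do not depend on the state: the lower one limits the mean holding times, the upper
    one forces real time to pass at least linearly with the mean number of jumps. *)
Lemma total_rate_bnd (x : state N) : arr_rate <= total x <= max_total.
Proof.
have E : total x = \sum_i (arr_rate + dep x i).
  rewrite /total_rate -(pair_bigA _ (fun i b => move_rate Q eps l N0 C L lam x (i, b)))/=.
  by apply: eq_bigr => i _; rewrite big_bool.
have NN : (0 < N * N)%N by rewrite muln_gt0 N_gt0.
rewrite E; apply/andP; split.
  rewrite (bigD1 (Ordinal NN))//= -[X in X <= _]addr0 lerD//.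
    by rewrite lerDl; case/andP: (dep_rate_bnd x (Ordinal NN)).
  apply: sumr_ge0 => i _; rewrite addr_ge0 ?(ltW arr_rate_gt0)//.
  by case/andP: (dep_rate_bnd x i).
rewrite /max_total -[X in _ <= X%:R * _]card_ord mulr_natl -sumr_const.
by apply: ler_sum => i _; rewrite lerD2l; case/andP: (dep_rate_bnd x i).
Qed.

Lemma total_rate_gt0 (x : state N) : 0 < total x.
Proof. by have /andP[h _] := total_rate_bnd x; exact: lt_le_trans arr_rate_gt0 h. Qed.
End Rates.

(** * Words driven by independent uniforms *)

Lemma measure_seq_disjoint d (T : measurableType d) (R : realType)
    (mu : {measure set T -> \bar R}) (A : eqType) (B : A -> set T) (s : seq A) :
  uniq s -> (forall a, measurable (B a)) -> (forall a b x, B a x -> B b x -> a = b) ->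
  measurable [set x | exists2 a, a \in s & B a x] /\
  mu [set x | exists2 a, a \in s & B a x] = (\sum_(a <- s) mu (B a))%E.
Proof.
move=> us mB dB; elim: s us => [_|a s IH /= /andP[as_ /IH[m1 m2]]].
  rewrite big_nil (_ : [set x | _] = set0) ?measure0//.
  by apply/seteqP; split=> // x [].
have -> : [set x | exists2 b, b \in a :: s & B b x] =
    B a `|` [set x | exists2 b, b \in s & B b x].
  apply/seteqP; split=> [x [b]|x [Bx|[b bs Bx]]].
  - by rewrite inE => /orP[/eqP ->|bs] Bx; [left|right; exists b].
  - by exists a; rewrite ?mem_head.
  - by exists b => //; rewrite inE bs orbT.
split; first exact: measurableU.
rewrite big_cons -m2; apply: measureU => //.
apply/seteqP; split=> // x [Bx [b bs Bbx]].
by move/negP : as_; rewrite (dB _ _ _ Bx Bbx).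
Qed.

Lemma measure_seq_le d (T : measurableType d) (R : realType)
    (mu : {measure set T -> \bar R}) (A : eqType) (B : A -> set T) (s : seq A) (v : A -> R) :
  (forall a, a \in s -> measurable (B a) /\ (mu (B a) <= (v a)%:E)%E) ->
  measurable [set x | exists2 a, a \in s & B a x] /\
  (mu [set x | exists2 a, a \in s & B a x] <= (\sum_(a <- s) v a)%:E)%E.
Proof.
elim: s => [_|a s IH H].
  rewrite big_nil (_ : [set x | _] = set0) ?measure0//.
  by apply/seteqP; split=> // x [].
have -> : [set x | exists2 b, b \in a :: s & B b x] =
    B a `|` [set x | exists2 b, b \in s & B b x].
  apply/seteqP; split=> [x [b]|x [Bx|[b bs Bx]]].
  - by rewrite inE => /orP[/eqP ->|bs] Bx; [left|right; exists b].
  - by exists a; rewrite ?mem_head.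
  - by exists b => //; rewrite inE bs orbT.
have [ma va] := H a (mem_head _ _).
have [ms vs] := IH (fun b bs => H b (mem_behead (s := a :: s) bs)).
split; first exact: measurableU.
rewrite (le_trans (measureU2 _ ma ms))// big_cons EFinD.
exact: leeD.
Qed.

Section Histories.
Variables (R : realType) (d : measure_display) (T : measurableType d) (P : probability T R).
Variable (U : nat -> T -> R).
Hypothesis hU : iid_uniform01 P U.
Variables (A : finType) (pick : seq A -> R -> A).
Hypothesis mpick : forall h a, measurable (pick h @^-1` [set a]).

(* Histories are stored most recent letter first. *)
Fixpoint hist (n : nat) (w : T) : seq A :=
  if n is n'.+1 then pick (hist n' w) (U n' w) :: hist n' w else [::].

(** The conditional law of the next letter after [h]: the uniform that selects this letter is
    independent of those that produced [h]. *)
Definition prob (h : seq A) (a : A) : R :=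
  fine (lebesgue_measure (pick h @^-1` [set a] `&` `[0, 1]%classic)).

Fixpoint weight (h : seq A) : R :=
  if h is a :: h' then weight h' * prob h' a else 1.

Fixpoint all_seqs (n : nat) : seq (seq A) :=
  if n is n'.+1 then [seq a :: h | h <- all_seqs n', a <- enum A] else [:: [::]].

Lemma probE h a : (prob h a)%:E = lebesgue_measure (pick h @^-1` [set a] `&` `[0, 1]%classic).
Proof.
rewrite fineK// ge0_fin_numE//.
apply: (@le_lt_trans _ _ (lebesgue_measure (`[0, 1]%classic : set R))).
  apply: le_measure; rewrite ?inE//.
  by apply: measurableI => //; exact: mpick.
by rewrite lebesgue_measure_itv/= lte_fin ltr01 oppr0 adde0 ltry.
Qed.

Lemma prob_ge0 h a : 0 <= prob h a.
Proof. exact: fine_ge0. Qed.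

Lemma weight_ge0 h : 0 <= weight h.
Proof. by elim: h => [|a h IH] //=; rewrite mulr_ge0 ?prob_ge0. Qed.

Lemma sum_prob h : \sum_a prob h a = 1.
Proof.
apply: EFin_inj; rewrite -sumEFin; under eq_bigr do rewrite probE.
have [] := @measure_seq_disjoint _ _ _ (@lebesgue_measure R) A
  (fun a => pick h @^-1` [set a] `&` `[0, 1]%classic) (enum A) (enum_uniq A) _ _.
- by move=> a; apply: measurableI => //; exact: mpick.
- by move=> a b x [<- _] [<- _].
move=> _; rewrite big_enum/= => <-.
rewrite (_ : [set x | _] = `[0, 1]%classic).
  by rewrite lebesgue_measure_itv/= lte_fin ltr01 oppr0 adde0.
apply/seteqP; split=> [x [a _ []]//|x x01]; exists (pick h x) => //.
by rewrite mem_enum.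
Qed.

Lemma size_hist n w : size (hist n w) = n.
Proof. by elim: n => //= n ->. Qed.

Lemma mem_all_seqs n h : (h \in all_seqs n) = (size h == n).
Proof.
elim: n h => [|n IH] h; first by rewrite inE; case: h.
apply/allpairsP/idP => [[[h' a] /= [hh _ ->]]|].
  by rewrite /= eqSS -IH.
case: h => [//|a h]; rewrite /= eqSS -IH => hh.
by exists (h, a); rewrite mem_enum.
Qed.

Lemma big_all_seqs n (g : seq A -> R) :
  \sum_(h <- all_seqs n.+1) g h = \sum_(h <- all_seqs n) \sum_a g (a :: h).
Proof.
rewrite /= big_allpairs_dep/=; apply: eq_bigr => h _.
by rewrite big_enum.
Qed.

(** The set in which the [k]-th uniform must fall for the word [h] to be produced. *)
Fixpoint cyl (h : seq A) (k : nat) : set R :=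
  if h is a :: h' then
    if k == size h' then pick h' @^-1` [set a] else cyl h' k
  else setT.

Lemma measurable_cyl h k : measurable (cyl h k).
Proof. by elim: h => [|a h IH] //=; case: ifP. Qed.

(** Once the word is fixed, each choice constrains a single uniform, so the event is an intersection
    of events of distinct uniforms and independence gives the product. *)
Lemma prob_hist h : measurable [set w | hist (size h) w = h] /\
  P [set w | hist (size h) w = h] = (weight h)%:E.
Proof.
have [mU [uU iU]] := hU.
have E : [set w | hist (size h) w = h] =
    \bigcap_(k in [set k | k \in iota 0 (size h)]) (U k @^-1` cyl h k).
  elim: h => [|a h IH]; first by apply/seteqP; split.
  have E k : (k < size h)%N -> cyl (a :: h) k = cyl h k by move=> kh /=; rewrite ltn_eqF.
  apply/seteqP; split=> w.
    move=> /= [ea eh] k /=; rewrite -/(iota 0 (size h).+1) mem_iota add0n /= ltnS leq_eqVlt.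
    move=> /orP[/eqP ->|kh]; first by rewrite eqxx -{1}eh.
    have : [set w | hist (size h) w = h] w by [].
    by rewrite IH ltn_eqF// => /(_ k); apply; rewrite /= mem_iota.
  move=> H.
  have Hh : [set w | hist (size h) w = h] w.
    rewrite IH => k /=; rewrite mem_iota add0n /= => kh.
    rewrite -(E _ kh); apply: (H k).
    by rewrite /= -/(iota 0 (size h).+1) mem_iota/= add0n ltnW.
  rewrite /= Hh; congr (_ :: _).
  have : (cyl (a :: h) (size h)) (U (size h) w).
    by apply: (H (size h)); rewrite /= -/(iota 0 (size h).+1) mem_iota/= add0n.
  by rewrite /= eqxx.
rewrite E; split.
  apply: bigcap_measurableType => k _.
  by rewrite -[_ @^-1` _]setTI; apply: mU => //; exact: measurable_cyl.
rewrite (iU _ _ (iota_uniq _ _) (measurable_cyl h)).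
clear E; elim: h => [|a h IH]; first by rewrite big_nil.
rewrite -[size _]/(size h).+1 -addn1 iotaD big_cat/= big_seq1 add0n.
rewrite eqxx uU; last exact: mpick.
rewrite EFinM -IH probE; congr (_ * _)%E.
apply: eq_big_seq => k; rewrite mem_iota add0n /= => kh.
by rewrite ltn_eqF.
Qed.

Lemma prob_hist_pred n (S : pred (seq A)) :
  measurable [set w | S (hist n w)] /\
  (P [set w | S (hist n w)] <= (\sum_(h <- all_seqs n | S h) weight h)%:E)%E.
Proof.
have -> : [set w | S (hist n w)] =
    [set w | exists2 h, h \in [seq h <- all_seqs n | S h] & hist (size h) w = h].
  apply/seteqP; split=> w /=.
    move=> Sw; exists (hist n w); last by rewrite size_hist.
    by rewrite mem_filter Sw mem_all_seqs size_hist eqxx.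
  move=> [h]; rewrite mem_filter mem_all_seqs => /andP[Sh /eqP hn].
  by rewrite hn => ->.
rewrite -big_filter; apply: (measure_seq_le (B := fun h w => hist (size h) w = h)) => h _.
by have [m1 m2] := prob_hist h; split => //; rewrite -m2.
Qed.

(** Orthogonality of martingale increments: the cross term vanishes by the zero mean, so the second
    moment grows by at most [V] per letter. *)
Lemma hist_chebyshev (F : seq A -> R) (V : R) n b : F [::] = 0 ->
  (forall h, \sum_a prob h a * (F (a :: h) - F h) = 0) ->
  (forall h, \sum_a prob h a * (F (a :: h) - F h) ^+ 2 <= V) -> 0 < b ->
  measurable [set w | b <= `|F (hist n w)|] /\
  (P [set w | (b <= `|F (hist n w)|)%R] <= (n%:R * V / b ^+ 2)%:E)%E.
Proof.
move=> F0 F1 F2 b0.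
have [m1 m2] := prob_hist_pred n (fun h => b <= `|F h|).
split => //; apply: (le_trans m2); rewrite lee_fin.
have E : \sum_(h <- all_seqs n) weight h * F h ^+ 2 <= n%:R * V /\
    \sum_(h <- all_seqs n) weight h = 1.
  elim: n {m1 m2} => [|n [IH IH1]]; first by rewrite !big_seq1/= F0 expr0n/= mul0r mulr0.
  split; last first.
    rewrite big_all_seqs -IH1; apply: eq_bigr => h _ /=.
    by rewrite -mulr_sumr sum_prob mulr1.
  rewrite big_all_seqs -natr1 mulrDl mul1r.
  apply: (@le_trans _ _ (\sum_(h <- all_seqs n) (weight h * F h ^+ 2 + weight h * V))).
    apply: ler_sum => h _ /=.
    have -> : \sum_a weight h * prob h a * F (a :: h) ^+ 2 =
        weight h * (F h ^+ 2 * (\sum_a prob h a) + 2 * F h * (\sum_a prob h a * (F (a :: h) - F h))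
          + \sum_a prob h a * (F (a :: h) - F h) ^+ 2).
      rewrite !mulr_sumr -!big_split/= mulr_sumr; apply: eq_bigr => a _; ring.
    by rewrite sum_prob F1 mulr0 addr0 mulr1 -mulrDr ler_wpM2l ?weight_ge0// lerD2l.
  by rewrite big_split/= -mulr_suml IH1 mul1r lerD2r.
rewrite ler_pdivlMr ?exprn_gt0//; apply: le_trans E.1.
rewrite mulr_suml big_mkcond/=; apply: ler_sum => h _.
case: ifPn => [bF|_]; last by rewrite mulr_ge0 ?weight_ge0 ?sqr_ge0.
by rewrite ler_wpM2l ?weight_ge0// -[F h ^+ 2]real_normK ?num_real// lerXn2r// nnegrE// ltW.
Qed.
End Histories.

(** * Sampling a move and an exponential variable *)

Lemma ohead_filter (B : Type) (x0 : B) (a : pred B) (s : seq B) :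
  ohead [seq b <- s | a b] = if has a s then Some (nth x0 s (find a s)) else None.
Proof. by elim: s => //= b s IH; case: ifP. Qed.

Lemma big_option (R : nmodType) (B : finType) (F : option B -> R) :
  \sum_o F o = F None + \sum_b F (Some b).
Proof.
rewrite (bigD1 None)//=; congr (_ + _).
rewrite (reindex_omap Some id)/=; first by apply: eq_bigl => b; rewrite eqxx.
by case.
Qed.

Section Selection.
Variables (R : realType) (B : eqType) (s : seq B) (f : B -> R).
Hypotheses (us : uniq s) (f_ge0 : forall b, 0 <= f b).
Let tot := \sum_(b <- s) f b.
Hypothesis tot_gt0 : 0 < tot.
Let cum b := \sum_(b' <- take (index b s).+1 s) f b'.

Lemma sum_take_le i j : (i <= j)%N ->
  \sum_(b <- take i s) f b <= \sum_(b <- take j s) f b.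
Proof.
move=> ij; rewrite -[take j s](cat_take_drop i) big_cat/= take_takel//.
by rewrite lerDl sumr_ge0.
Qed.

(** Partial sums are nondecreasing, so the first one to exceed [u * tot] belongs to the half-open
    interval that contains [u * tot]. *)
Lemma selectP m u : m \in s -> 0 <= u ->
  (ohead [seq b <- s | u * tot < cum b] == Some m) =
  (\sum_(b <- take (index m s) s) f b <= u * tot < cum m).
Proof.
move=> ms u0; rewrite (ohead_filter m); set a := fun b => _ : bool.
have ut0 : 0 <= u * tot by rewrite mulr_ge0// ltW.
have cumE j : (j < size s)%N -> cum (nth m s j) = \sum_(b <- take j.+1 s) f b.
  by move=> js; rewrite /cum index_uniq.
apply/idP/idP => [|/andP[h1 h2]].
  case: ifP => // has_a /eqP[E].
  have fm : find a s = index m s by rewrite -E index_uniq// -has_find.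
  have am : a m by rewrite -E nth_find.
  rewrite [X in _ && X]am andbT -fm; case Ef : (find a s) => [|k]; first by rewrite take0 big_nil.
  have := @before_find _ m a s k; rewrite Ef ltnSn => /(_ isT)/negbT.
  rewrite /a -leNgt cumE//.
  by rewrite -ltnS -Ef ltnW// ltnS -has_find.
have has_a : has a s by apply/hasP; exists m.
rewrite has_a; apply/eqP; congr Some.
suff -> : find a s = index m s by rewrite nth_index.
apply/eqP; rewrite eqn_leq; apply/andP; split.
  rewrite leqNgt; apply/negP => /(before_find m).
  by rewrite nth_index// /a h2.
rewrite leqNgt; apply/negP => lt_f.
have := nth_find m has_a; rewrite /a cumE -?has_find//.
by apply/negP; rewrite -leNgt (le_trans _ h1)// sum_take_le.
Qed.

Lemma select_measurable o :
  measurable [set u : R | ohead [seq b <- s | u * tot < cum b] = o].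
Proof.
have mE b : measurable [set u : R | u * tot < cum b].
  rewrite (_ : [set _ | _] = `]-oo, cum b / tot[%classic).
    exact: measurable_itv.
  by apply/seteqP; split => u /=; rewrite in_itv/= ltr_pdivlMr.
(* Only the filtered list is generalised; [cum] still refers to the whole of [s]. *)
move: o; elim: (s) => [|b s' IH] o.
  by case: o => [b|]; [rewrite (_ : [set _ | _] = set0)|rewrite (_ : [set _ | _] = setT)] => //;
     apply/seteqP; split.
have -> : [set u | ohead [seq b0 <- b :: s' | u * tot < cum b0] = o] =
   ([set u | u * tot < cum b] `&` [set u | Some b = o]) `|`
   (~` [set u | u * tot < cum b] `&` [set u | ohead [seq b0 <- s' | u * tot < cum b0] = o]).
  apply/seteqP; split => u /=; case: ifP => //= E.
  - by move=> ?; left.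
  - by move=> ?; right.
  - by case=> [[_ ?]|[] //].
  - by case=> [[]|[]].
apply: measurableU; apply: measurableI => //.
- have [->|bo] := pselect (Some b = o); first by rewrite (_ : [set _ | _] = setT)//; apply/seteqP; split.
  by rewrite (_ : [set _ | _] = set0)//; apply/seteqP; split.
- exact: measurableC.
Qed.

Lemma select_prob m : m \in s ->
  lebesgue_measure ([set u : R | ohead [seq b <- s | u * tot < cum b] = Some m] `&` `[0, 1]%classic)
  = (f m / tot)%:E.
Proof.
move=> ms; set p := \sum_(b <- take (index m s) s) f b.
have cumE : cum m = p + f m.
  by rewrite /cum (take_nth m) ?index_mem// nth_index// big_rcons/= addrC.
have p0 : 0 <= p by rewrite sumr_ge0.
have ct : cum m <= tot.
  have := @sum_take_le (index m s).+1 (size s); rewrite take_size index_mem; exact.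
rewrite (_ : _ `&` _ = `[p / tot, cum m / tot[%classic).
  rewrite lebesgue_measure_itv/= lte_fin ltr_pM2r ?invr_gt0// cumE ltrDl.
  case: ifPn => fm; first by rewrite -EFinB; congr EFin; field; rewrite gt_eqF.
  have -> : f m = 0 by apply/eqP; rewrite eq_le f_ge0 andbT leNgt.
  by rewrite mul0r.
apply/seteqP; split => u /=; rewrite !in_itv/=.
  move=> [/eqP h /andP[u0 u1]].
  by rewrite ler_pdivrMr// ltr_pdivlMr// -selectP.
rewrite ler_pdivrMr// ltr_pdivlMr// => /andP[h1 h2].
have u0 : 0 <= u by rewrite -(pmulr_lge0 _ tot_gt0) (le_trans p0).
split; first by apply/eqP; rewrite selectP// h1.
rewrite u0/= -(ler_pM2r tot_gt0) mul1r ltW//.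
exact: lt_le_trans ct.
Qed.
End Selection.

Section Cells.
Variables (R : realType) (eta : R) (J : nat).
Hypothesis eta_gt0 : 0 < eta.
Let r := expR (- eta).

(* On the cell c < J the exponential variable - ln u lies in (c eta, (c + 1) eta]; the cell J collects the remaining u. *)
Definition cell (u : R) : 'I_J.+1 :=
  inord (find (fun j => r ^+ j.+1 <= u < r ^+ j) (iota 0 J)).

Lemma ratio_lt1 : 0 < r < 1.
Proof. by rewrite /r expR_gt0 expR_lt1 oppr_lt0. Qed.

Lemma cell_lt u : r ^+ J <= u < 1 -> (cell u < J)%N.
Proof.
move=> /andP[h1 h2]; pose a (j : nat) := r ^+ j.+1 <= u < r ^+ j.
rewrite /cell -/a.
suff h : has a (iota 0 J).
  by rewrite inordK; move: h; rewrite has_find size_iota// => /ltnW.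
elim: J h1 => [|j IH] h1; first by move: h1 h2; rewrite expr0 => h1 /(le_lt_trans h1); rewrite ltxx.
rewrite -addn1 iotaD has_cat/= add0n orbF.
have [h|h] := leP (r ^+ j) u; first by rewrite IH.
by rewrite /a h1 h orbT.
Qed.

Lemma cellP u : (cell u < J)%N -> r ^+ (cell u).+1 <= u < r ^+ (cell u).
Proof.
rewrite /cell; pose a (j : nat) := r ^+ j.+1 <= u < r ^+ j; rewrite -/a => h.
have fJ : (find a (iota 0 J) < J)%N.
  move: h; rewrite inordK//.
  by have := find_size a (iota 0 J); rewrite size_iota ltnS.
have : has a (iota 0 J) by rewrite has_find size_iota.
move=> /(nth_find 0%N); rewrite nth_iota// add0n.
by rewrite inordK// ltnW.
Qed.

Lemma cell_eq u (c : 'I_J.+1) : (c < J)%N -> r ^+ c.+1 <= u < r ^+ c -> cell u = c.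
Proof.
move=> cJ /andP[h1 h2].
have /andP[r0 r1] := ratio_lt1.
have hJ : (cell u < J)%N.
  apply: cell_lt; rewrite (le_trans _ h1) ?ler_wiXn2l ?(ltW r0) ?(ltW r1)//=.
  by rewrite (lt_le_trans h2)// exprn_ile1// ltW.
have /andP[g1 g2] := cellP hJ.
apply/val_inj/eqP; rewrite eqn_leq /=; apply/andP; split; rewrite leqNgt; apply/negP => lt_c.
- have h : r ^+ cell u <= r ^+ c.+1 by rewrite ler_wiXn2l// ltW.
  by have := lt_le_trans g2 (le_trans h h1); rewrite ltxx.
- have h : r ^+ c <= r ^+ (cell u).+1 by rewrite ler_wiXn2l// ltW.
  by have := lt_le_trans h2 (le_trans h g1); rewrite ltxx.
Qed.

Lemma cell_ln u : r ^+ J <= u < 1 ->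
  0 < - ln u /\ eta * (cell u)%:R <= - ln u <= eta * (cell u)%:R + eta.
Proof.
move=> uJ; have /andP[h1 h2] := cellP (cell_lt uJ).
have u0 : 0 < u by apply: lt_le_trans h1; rewrite exprn_gt0// expR_gt0.
have /andP[_ u1] := uJ.
have lnr n : ln (r ^+ n) = - (eta * n%:R).
  by rewrite lnXn ?expR_gt0// expRK mulNrn mulr_natr.
split; first by rewrite oppr_gt0 ln_lt0// u0.
apply/andP; split.
  by rewrite lerNr -lnr ler_ln ?posrE ?exprn_gt0 ?expR_gt0// ltW.
have -> : eta * (cell u)%:R + eta = - ln (r ^+ (cell u).+1) by rewrite lnr -natr1; ring.
by rewrite lerN2 ler_ln ?posrE ?exprn_gt0 ?expR_gt0.
Qed.
End Cells.

Section CellLaw.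
Variables (R : realType) (eta : R) (J : nat).
Hypothesis eta_gt0 : 0 < eta.
Let r := expR (- eta).
Local Notation cell := (@cell R eta J).

Lemma cell_preimage (c : 'I_J.+1) : (c < J)%N ->
  cell @^-1` [set c] = `[r ^+ c.+1, r ^+ c[%classic.
Proof.
move=> cJ; apply/seteqP; split=> u /=; rewrite in_itv/=.
  by move=> E; rewrite -E; apply: cellP => //; rewrite E.
by move=> h; apply: cell_eq.
Qed.

Lemma measurable_cell (c : 'I_J.+1) : measurable (cell @^-1` [set c]).
Proof.
have [cJ|Jc] := ltnP c J; first by rewrite cell_preimage.
have -> : cell @^-1` [set c] = ~` (\bigcup_(b in [set b : 'I_J.+1 | (b < J)%N]) cell @^-1` [set b]).
  apply/seteqP; split=> u /=.
    by move=> E [b /= bJ] Eb; move: bJ; rewrite -Eb E ltnNge Jc.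
  move=> h.
  have Ju : (J <= cell u)%N by rewrite leqNgt; apply/negP => uJ; apply: h; exists (cell u).
  have EJ (b : 'I_J.+1) : (J <= b)%N -> b = J :> nat.
    by move=> Jb; apply/eqP; rewrite eqn_leq Jb -ltnS ltn_ord.
  by apply/val_inj; rewrite /= (EJ _ Ju) (EJ _ Jc).
apply: measurableC; apply: fin_bigcup_measurable => // b bJ.
by rewrite cell_preimage.
Qed.

Lemma cell_measure (c : 'I_J.+1) : (c < J)%N ->
  lebesgue_measure (cell @^-1` [set c] `&` `[0, 1]%classic) = (r ^+ c - r ^+ c.+1)%:E.
Proof.
move=> cJ; have /andP[r0 r1] := ratio_lt1 eta_gt0; rewrite -/r in r0 r1.
rewrite cell_preimage// setIidl.
  rewrite lebesgue_measure_itv/= lte_fin ifT ?EFinB//.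
  by rewrite exprS gtr_pMl// exprn_gt0.
move=> u /=; rewrite !in_itv/= => /andP[h1 h2].
rewrite (le_trans _ h1) ?exprn_ge0 ?(ltW r0)//=.
by rewrite (le_trans (ltW h2))// exprn_ile1// ltW.
Qed.

(** A geometric law truncated at [J]: induction on the truncation level gives the first moment
    exactly and bounds the second. The inequalities [1 - eta <= r] and [eta * r <= 1 - r] then
    compare the mean with 1, the mean of the exponential variable. *)
Lemma cell_moments (p : 'I_J.+1 -> R) : \sum_c p c = 1 ->
  (forall c : 'I_J.+1, (c < J)%N -> p c = r ^+ c - r ^+ c.+1) -> r ^+ J <= eta ->
  1 - 2 * eta <= \sum_c p c * (eta * c%:R) <= 1 /\
  \sum_c p c * (eta * c%:R) ^+ 2 <= 2 * eta ^+ 2 / (1 - r) ^+ 2.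
Proof.
move=> p1 pE rJ; have /andP[r0 r1] := ratio_lt1 eta_gt0; rewrite -/r in r0 r1.
have tele n : \sum_(c < n) (r ^+ c - r ^+ c.+1) = 1 - r ^+ n.
  elim: n => [|n IH]; first by rewrite big_ord0 expr0 subrr.
  by rewrite big_ord_recr/= IH; ring.
have pJ : p ord_max = r ^+ J.
  move: p1; rewrite big_ord_recr/= => p1.
  have : p ord_max = 1 - \sum_(c < J) p (widen_ord (leqnSn J) c) by rewrite -p1; ring.
  move=> ->; under eq_bigr => c _ do rewrite (pE (widen_ord (leqnSn J) c) (ltn_ord c)) /=.
  by rewrite tele; ring.
have E (g : nat -> R) : \sum_c p c * g c =
    \sum_(c < J) (r ^+ c - r ^+ c.+1) * g c + r ^+ J * g J.
  rewrite big_ord_recr/= pJ; congr (_ + _); apply: eq_bigr => c _.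
  by rewrite (pE (widen_ord (leqnSn J) c) (ltn_ord c)).
rewrite (E (fun c => eta * c%:R)) (E (fun c => (eta * c%:R) ^+ 2)).
have m1 n : (1 - r) * (\sum_(c < n) (r ^+ c - r ^+ c.+1) * (eta * c%:R) + r ^+ n * (eta * n%:R))
    = eta * r * (1 - r ^+ n).
  elim: n => [|n IH]; first by rewrite big_ord0 expr0; ring.
  have -> : eta * r * (1 - r ^+ n.+1) = eta * r * (1 - r ^+ n) + (1 - r) * (eta * r ^+ n.+1).
    by rewrite exprS; ring.
  by rewrite -IH big_ord_recr/= exprS -natr1; ring.
have m2 n : (1 - r) ^+ 2 * (\sum_(c < n) (r ^+ c - r ^+ c.+1) * (eta * c%:R) ^+ 2 + r ^+ n * (eta * n%:R) ^+ 2)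
    <= 2 * eta ^+ 2 * (1 - r ^+ n * (1 + n%:R * (1 - r))).
  elim: n => [|n IH]; first by rewrite big_ord0 expr0 le_eqVlt; apply/orP; left; apply/eqP; ring.
  have -> : 2 * eta ^+ 2 * (1 - r ^+ n.+1 * (1 + n.+1%:R * (1 - r))) =
     2 * eta ^+ 2 * (1 - r ^+ n * (1 + n%:R * (1 - r)))
     + 2 * eta ^+ 2 * ((n%:R + 1) * r ^+ n * (1 - r) ^+ 2).
    by rewrite [r ^+ n.+1]exprS -natr1; ring.
  have -> : (1 - r) ^+ 2 * (\sum_(c < n.+1) (r ^+ c - r ^+ c.+1) * (eta * c%:R) ^+ 2
      + r ^+ n.+1 * (eta * n.+1%:R) ^+ 2) =
     (1 - r) ^+ 2 * (\sum_(c < n) (r ^+ c - r ^+ c.+1) * (eta * c%:R) ^+ 2 + r ^+ n * (eta * n%:R) ^+ 2)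
     + eta ^+ 2 * ((2 * n%:R + 1) * (r * r ^+ n) * (1 - r) ^+ 2).
    by rewrite big_ord_recr/= [r ^+ n.+1]exprS -natr1; ring.
  apply: lerD => //.
  have -> : 2 * eta ^+ 2 * ((n%:R + 1) * r ^+ n * (1 - r) ^+ 2) =
     eta ^+ 2 * ((2 * n%:R + 2) * r ^+ n * (1 - r) ^+ 2) by ring.
  rewrite ler_wpM2l ?sqr_ge0// ler_wpM2r ?sqr_ge0//.
  apply: ler_pM; rewrite ?addr_ge0 ?mulr_ge0 ?exprn_ge0 ?(ltW r0)//.
    by rewrite lerD2l ler1n.
  by rewrite ler_piMl ?exprn_ge0 ?(ltW r0)// ltW.
have q0 : 0 < 1 - r by lra.
have e0 : 0 < eta by exact: eta_gt0.
have rJ0 : 0 <= r ^+ J by rewrite exprn_ge0// ltW.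
have rJ1 : r ^+ J <= 1 by rewrite exprn_ile1// ltW.
have q1 : 1 - eta <= r.
  by rewrite /r; apply: le_trans (expR_ge1Dx _).
have q2 : eta * r <= 1 - r.
  have : (1 + eta) * r <= 1.
    apply: (@le_trans _ _ (expR eta * r)); first by rewrite ler_pM2r// expR_ge1Dx.
    by rewrite /r -expRD subrr expR0.
  lra.
set M1 := _ + _ in m1 *; split.
  have {}m1 := m1 J; rewrite -/M1 in m1.
  apply/andP; split.
    rewrite -(ler_pM2l q0) m1.
    have [h|h] := leP (1 - 2 * eta) 0.
      apply: (@le_trans _ _ 0); first by rewrite mulr_ge0_le0// ltW.
      by rewrite !mulr_ge0 ?(ltW e0) ?(ltW r0) ?subr_ge0.
    apply: (@le_trans _ _ (eta * (1 - 2 * eta))).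
      by rewrite ler_wpM2r ?(ltW h)//; lra.
    rewrite -mulrA ler_pM2l//.
    have k1 : 0 <= (r - (1 - eta)) * (1 - r ^+ J) by rewrite mulr_ge0 ?subr_ge0.
    have k2 : 0 <= (1 - eta) * (eta - r ^+ J).
      by rewrite mulr_ge0 ?subr_ge0//; lra.
    have k3 : 0 <= eta ^+ 2 by exact: sqr_ge0.
    have -> : r * (1 - r ^+ J) = 1 - 2 * eta + ((r - (1 - eta)) * (1 - r ^+ J)
      + (1 - eta) * (eta - r ^+ J) + eta ^+ 2) by ring.
    by rewrite lerDl addr_ge0// addr_ge0.
  rewrite -(ler_pM2l q0) m1 mulr1; apply: le_trans q2.
  by rewrite ler_piMr ?mulr_ge0 ?(ltW e0) ?(ltW r0)// lerBlDr lerDl.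
rewrite ler_pdivlMr ?exprn_gt0// mulrC; apply: (le_trans (m2 J)).
apply: ler_piMr; first by rewrite mulr_ge0 ?sqr_ge0.
by rewrite lerBlDr lerDl mulr_ge0// addr_ge0// mulr_ge0// ltW.
Qed.
End CellLaw.

(** * Martingales of the chain *)

Section ChainHistory.
Variables (R : realType) (Q eps : R) (N : nat) (l : R -> R) (N0 C L lam : R).
Hypotheses (eps_gt0 : 0 < eps) (N_gt0 : (0 < N)%N).
Hypotheses (N0_gt0 : 0 < N0) (C_gt0 : 0 < C) (L_gt0 : 0 < L) (lam_gt0 : 0 < lam).
Hypotheses (w_ge0 : forall i j, 0 <= @l_eps R Q eps N l i j)
  (w_diag : forall i, @l_eps R Q eps N l i i = 1).
Variables (y0 : state N) (eta : R) (J : nat).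
Hypothesis eta_gt0 : 0 < eta.

Local Notation move := ('I_(N * N) * bool)%type.
Local Notation letter := ('I_J.+1 + option move)%type.
Local Notation dep := (@dep_rate R Q eps N l N0 C L).
Local Notation total := (@total_rate R Q eps N l N0 C L lam).
Local Notation rate := (@move_rate R Q eps N l N0 C L lam).
Local Notation arr := (arr_rate eps lam).
Let r := expR (- eta).

Fixpoint hist_state (h : seq letter) : state N :=
  match h with
  | [::] => y0
  | a :: h' => if a is inr (Some m) then apply_move (hist_state h') m else hist_state h'
  end.

(* Even letters record the cell of the holding-time uniform, odd letters the selected move. *)
Definition chain_pick (h : seq letter) (u : R) : letter :=
  if odd (size h) then
    let s := enum {: move} in
    inr (ohead [seq m <- s | u * total (hist_state h) <
           \sum_(m' <- take (index m s).+1 s) rate (hist_state h) m'])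
  else inl (cell eta J u).

Lemma total_rateE x : total x = \sum_(m <- enum {: move}) rate x m.
Proof. by rewrite /total_rate big_enum. Qed.

Lemma total_gt0 x : 0 < total x.
Proof. exact: total_rate_gt0. Qed.

Lemma rate_ge0 x m : 0 <= rate x m.
Proof. exact: move_rate_ge0. Qed.

Lemma measurable_chain_pick h a : measurable (chain_pick h @^-1` [set a]).
Proof.
rewrite /chain_pick /preimage /=; case: (odd (size h)); case: a => [c|o].
- by rewrite (_ : [set _ | _] = set0)//; apply/seteqP; split.
- have := @select_measurable R move (enum {: move}) (rate (hist_state h)) _ o.
  rewrite -total_rateE => /(_ (total_gt0 _)).
  congr measurable; apply/seteqP; split => u /=; first by move=> ->.
  by move=> [->].
- have := @measurable_cell R eta J eta_gt0 c.
  congr measurable; apply/seteqP; split => u /=; first by move=> ->.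
  by move=> [->].
- by rewrite (_ : [set _ | _] = set0)//; apply/seteqP; split.
Qed.

Local Notation pr := (@prob R _ chain_pick).

Lemma prob_odd_inl h c : odd (size h) -> pr h (inl c) = 0.
Proof.
move=> oh; rewrite /prob.
rewrite (_ : _ @^-1` _ = set0) ?set0I ?measure0//.
by apply/seteqP; split=> u //=; rewrite /chain_pick oh.
Qed.

Lemma prob_even_inr h o : ~~ odd (size h) -> pr h (inr o) = 0.
Proof.
move=> /negbTE oh; rewrite /prob.
rewrite (_ : _ @^-1` _ = set0) ?set0I ?measure0//.
by apply/seteqP; split=> u //=; rewrite /chain_pick oh.
Qed.

Lemma prob_odd_move h m : odd (size h) ->
  pr h (inr (Some m)) = rate (hist_state h) m / total (hist_state h).
Proof.
move=> oh; rewrite /prob.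
have := @select_prob R move (enum {: move}) (rate (hist_state h)) (enum_uniq _)
  (rate_ge0 _) _ m _.
rewrite -total_rateE mem_enum => /(_ (total_gt0 _) isT) H.
rewrite (_ : _ @^-1` _ = [set u : R | ohead [seq b <- enum {: move} | u * total (hist_state h) <
  \sum_(b' <- take (index b (enum {: move})).+1 (enum {: move})) rate (hist_state h) b'] = Some m]).
  by rewrite H.
apply/seteqP; split=> u /=; rewrite /chain_pick oh /=; first by move=> [].
by move=> ->.
Qed.

Lemma prob_even_cell h c : ~~ odd (size h) ->
  pr h (inl c) = fine (lebesgue_measure (cell eta J @^-1` [set c] `&` `[0, 1]%classic)).
Proof.
move=> /negbTE oh; rewrite /prob; congr (fine (lebesgue_measure (_ `&` _))).
by apply/seteqP; split=> u /=; rewrite /chain_pick oh; [move=> []|move=> ->].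
Qed.

Lemma sum_prob_chain h : \sum_a pr h a = 1.
Proof. exact: (sum_prob measurable_chain_pick). Qed.

(** The compensator of coordinate [i] in the embedded chain. A letter is charged by the parity of
    the history before it, so only selected moves contribute. *)
Fixpoint hist_drift (i : 'I_(N * N)) (h : seq letter) : R :=
  if h is a :: h' then hist_drift i h' +
    (if odd (size h') then (arr - dep (hist_state h') i) / total (hist_state h') else 0)
  else 0.

Definition state_mart (i : 'I_(N * N)) (h : seq letter) : R :=
  (hist_state h i)%:R - (y0 i)%:R - hist_drift i h.

Lemma drift_le1 x i : `|(arr - dep x i) / total x| <= 1.
Proof.
have t0 := total_gt0 x.
rewrite normrM normfV (gtr0_norm t0) ler_pdivrMr// mul1r.
have /andP[h1 _] : arr <= total x <= max_total eps N N0 C L lam by exact: total_rate_bnd.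
have h2 : dep x i <= total x.
  rewrite /total_rate (bigD1 (i, false))//= lerDl sumr_ge0// => m _; exact: rate_ge0.
have h3 : 0 <= dep x i := rate_ge0 x (i, false).
have h4 : 0 <= arr := rate_ge0 x (i, true).
by rewrite ler_norml; apply/andP; split; lra.
Qed.

Lemma apply_move_diff (x : state N) m i :
  (apply_move x m i)%:R - (x i)%:R =
  (if i == m.1 then (if m.2 then 1 else - (0 < x i)%N%:R) else 0) :> R.
Proof.
rewrite /apply_move; case: ifP => _; last by rewrite subrr.
case: m.2; first by rewrite -natr1 [_ + 1]addrC addrK.
by case: (x i) => [|n] /=; rewrite ?subrr ?oppr0// -natr1 opprD addrA subrr sub0r.
Qed.

Lemma state_mart_step i h a : state_mart i (a :: h) - state_mart i h =
  (hist_state (a :: h) i)%:R - (hist_state h i)%:R -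
    (if odd (size h) then (arr - dep (hist_state h) i) / total (hist_state h) else 0).
Proof. by rewrite /state_mart /=; ring. Qed.

Lemma hist_state_step i h a : `|(hist_state (a :: h) i)%:R - (hist_state h i)%:R| <= 1 :> R.
Proof.
case: a => [c|[m|]] /=; rewrite ?subrr ?normr0// apply_move_diff.
by case: ifP; case: m.2; rewrite ?normrN ?normr1 ?normr0//; case: (0 < _)%N; rewrite ?normr1 ?normr0.
Qed.

Lemma state_mart_step_le i h a : `|state_mart i (a :: h) - state_mart i h| <= 2.
Proof.
rewrite state_mart_step (le_trans (ler_normB _ _))// (_ : 2 = 1 + 1)// lerD ?hist_state_step//.
by case: ifP; rewrite ?normr0// drift_le1.
Qed.

Lemma state_mart_mean i h : \sum_a pr h a * (state_mart i (a :: h) - state_mart i h) = 0.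
Proof.
under eq_bigr do rewrite state_mart_step.
case: ifPn => oh; rewrite big_sumType/=; last first.
  rewrite !big1 ?addr0//; first by move=> o _; rewrite prob_even_inr// mul0r.
  by move=> c _; rewrite subrr subr0 mulr0.
set x := hist_state h; set dl := _ / _.
under eq_bigr do rewrite prob_odd_inl// mul0r.
rewrite big1_eq add0r.
under eq_bigr do rewrite mulrBr.
rewrite sumrB -mulr_suml.
have -> : \sum_(o : option move) pr h (inr o) = 1.
  rewrite -(sum_prob_chain h) big_sumType/= [X in _ = X + _]big1 ?add0r// => c _.
  exact: prob_odd_inl.
rewrite big_option /= subrr mulr0 add0r mul1r.
under eq_bigr do rewrite prob_odd_move// -/x apply_move_diff.
apply/eqP; rewrite subr_eq0; apply/eqP.
rewrite -(pair_bigA _ (fun j b => rate x (j, b) / total x *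
   (if i == j then (if b then 1 else - (0 < x i)%N%:R) else 0)))/=.
rewrite (bigD1 i)//= [X in _ + X]big1; last first.
  move=> j /negbTE ji; by rewrite big1// => b _; rewrite eq_sym ji mulr0.
rewrite big_bool/= eqxx addr0 /dl /move_rate/= -/arr.
(* A departure from an empty square would leave the state unchanged, but its rate is 0, so the
   compensator is still exact. *)
case: (posnP (x i)) => xi /=; last by rewrite mulrN1 mulr1 mulrBl.
by rewrite dep_rate0// !mul0r addr0 subr0 mulr1.
Qed.

Lemma state_mart_var i h : \sum_a pr h a * (state_mart i (a :: h) - state_mart i h) ^+ 2 <= 4.
Proof.
apply: (@le_trans _ _ (\sum_a pr h a * 4)); last by rewrite -mulr_suml sum_prob_chain mul1r.
apply: ler_sum => a _; rewrite ler_wpM2l ?prob_ge0//.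
rewrite -real_normK ?num_real// (_ : 4 = 2 ^+ 2) ?lerXn2r ?nnegrE// ?state_mart_step_le//.
by rewrite -natrX.
Qed.

Let cell_prob (c : 'I_J.+1) : R :=
  fine (lebesgue_measure (cell eta J @^-1` [set c] `&` `[0, 1]%classic)).
Definition cell_mean : R := \sum_c cell_prob c * (eta * c%:R).
Definition letter_time (a : letter) : R := if a is inl c then eta * c%:R else 0.

(** Centering at the mean of the rounded variable instead of 1 makes this an exact martingale; the
    bias is left to [jump_time_near]. *)
Fixpoint time_mart (h : seq letter) : R :=
  if h is a :: h' then time_mart h' +
    (if odd (size h') then 0 else (letter_time a - cell_mean) / total (hist_state h'))
  else 0.

Lemma sum_cell_prob : \sum_c cell_prob c = 1.
Proof.
rewrite -(sum_prob_chain [::]) big_sumType/= [X in _ = _ + X]big1 ?addr0.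
  by apply: eq_bigr => c _; rewrite prob_even_cell.
by move=> o _; rewrite prob_even_inr.
Qed.

Lemma cell_mean_bnd : r ^+ J <= eta ->
  1 - 2 * eta <= cell_mean <= 1 /\
  \sum_c cell_prob c * (eta * c%:R) ^+ 2 <= 2 * eta ^+ 2 / (1 - r) ^+ 2.
Proof.
move=> rJ; apply: cell_moments => //; first exact: sum_cell_prob.
by move=> c cJ; rewrite /cell_prob cell_measure.
Qed.

Lemma time_mart_mean h : \sum_a pr h a * (time_mart (a :: h) - time_mart h) = 0.
Proof.
rewrite /= ; under eq_bigr do rewrite addrC addrA addNr add0r.
case: (boolP (odd (size h))) => oh; first by rewrite -mulr_suml mulr0.
rewrite big_sumType/= [X in _ + X]big1 ?addr0; last by move=> o _; rewrite prob_even_inr// mul0r.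
under eq_bigr do rewrite mulrA.
rewrite -mulr_suml (eq_bigr (fun c => cell_prob c * (eta * c%:R) - cell_prob c * cell_mean)).
  by rewrite sumrB -mulr_suml sum_cell_prob mul1r subrr mul0r.
by move=> c _; rewrite prob_even_cell// mulrBr.
Qed.

Lemma time_mart_var h : r ^+ J <= eta ->
  \sum_a pr h a * (time_mart (a :: h) - time_mart h) ^+ 2 <= 2 * eta ^+ 2 / (1 - r) ^+ 2 / arr ^+ 2.
Proof.
move=> rJ; have [_ m2] := cell_mean_bnd rJ.
have a0 : 0 < arr by exact: arr_rate_gt0.
rewrite /= ; under eq_bigr do rewrite addrC addrA addNr add0r.
case: (boolP (odd (size h))) => oh.
  rewrite -mulr_suml expr0n/= mulr0 divr_ge0 ?sqr_ge0//.
  by rewrite divr_ge0 ?sqr_ge0// mulr_ge0// sqr_ge0.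
rewrite big_sumType/= [X in _ + X]big1 ?addr0; last by move=> o _; rewrite prob_even_inr// mul0r.
set x := hist_state h; have t0 := total_gt0 x.
have /andP[h1 _] : arr <= total x <= max_total eps N N0 C L lam by exact: total_rate_bnd.
have V : \sum_c cell_prob c * (eta * c%:R - cell_mean) ^+ 2 <= 2 * eta ^+ 2 / (1 - r) ^+ 2.
  apply: le_trans m2.
  rewrite (eq_bigr (fun c => cell_prob c * (eta * c%:R) ^+ 2
     + (cell_prob c * (eta * c%:R) * (- (2 * cell_mean)) + cell_prob c * cell_mean ^+ 2))); last first.
    by move=> c _; ring.
  rewrite !big_split/= -!mulr_suml sum_cell_prob -/cell_mean gerDl.
  have -> : cell_mean * - (2 * cell_mean) + 1 * cell_mean ^+ 2 = - cell_mean ^+ 2 by ring.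
  by rewrite oppr_le0 sqr_ge0.
rewrite (eq_bigr (fun c => cell_prob c * (eta * c%:R - cell_mean) ^+ 2 / total x ^+ 2)); last first.
  by move=> c _; rewrite prob_even_cell// exprMn exprVn mulrA.
rewrite -mulr_suml ler_pM ?invr_ge0 ?sqr_ge0//.
  by rewrite sumr_ge0// => c _; rewrite mulr_ge0 ?sqr_ge0// fine_ge0.
by rewrite lef_pV2 ?posrE ?exprn_gt0// lerXn2r// nnegrE ltW.
Qed.
End ChainHistory.

(** * Interpolation between the points of a grid *)

Section Grid.
Variable R : realType.

Lemma grid_bound (F : nat -> R) (c b : R) (s G : nat) : (0 < s)%N ->
  (forall k, `|F k.+1 - F k| <= c) -> (forall j, (j <= G)%N -> `|F (j * s)%N| <= b) ->
  forall k, (k <= G * s)%N -> `|F k| <= b + c * s%:R.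
Proof.
move=> s0 Fc Fb k kG.
have c0 : 0 <= c := le_trans (normr_ge0 _) (Fc 0%N).
have inc p q : `|F (p + q)%N - F p| <= c * q%:R.
  elim: q => [|q IH]; first by rewrite addn0 subrr normr0 mulr0.
  have -> : F (p + q.+1)%N - F p = (F (p + q).+1 - F (p + q)%N) + (F (p + q)%N - F p).
    by rewrite addnS; ring.
  by rewrite (le_trans (ler_normD _ _))// -natr1 mulrDr mulr1 addrC lerD.
rewrite (divn_eq k s).
set p := (k %/ s * s)%N; set q := (k %% s)%N.
have -> : F (p + q)%N = F p + (F (p + q)%N - F p) by ring.
rewrite (le_trans (ler_normD _ _))// lerD//.
  apply: Fb; rewrite -(leq_pmul2r s0).
  by apply: leq_trans kG; exact: leq_divM.
by rewrite (le_trans (inc _ _))// ler_wpM2l// ler_nat ltnW// ltn_mod.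
Qed.

(** For jump times, where the increments of [F] are exponential variables without a deterministic
    bound. Monotonicity squeezes [F k] between its values at the two neighbouring grid points, and
    [H] varies little between these. *)
Lemma grid_mono (F H : nat -> R) (c b : R) (s G : nat) : (0 < s)%N ->
  (forall k, (k < G * s)%N -> F k <= F k.+1) -> (forall k, 0 <= H k.+1 - H k <= c) ->
  (forall j, (j <= G)%N -> `|F (j * s)%N - H (j * s)%N| <= b) ->
  forall k, (k < G * s)%N -> `|F k - H k| <= b + c * s%:R.
Proof.
move=> s0 Fm Hc FH k kG.
have Finc p q : (p + q <= G * s)%N -> F p <= F (p + q)%N.
  elim: q => [|q IH] pq; first by rewrite addn0.
  rewrite addnS in pq *; rewrite (le_trans (IH (ltnW pq)))//; exact: Fm.
have Hinc p q : 0 <= H (p + q)%N - H p <= c * q%:R.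
  elim: q => [|q /andP[IH1 IH2]]; first by rewrite addn0 subrr mulr0 lexx.
  have /andP[h1 h2] := Hc (p + q)%N.
  by rewrite addnS -natr1; apply/andP; split; lra.
set j := (k %/ s)%N; set q := (k %% s)%N.
have ek : k = (j * s + q)%N by exact: divn_eq.
have qs : (q <= s)%N by rewrite ltnW// ltn_mod.
have jG : (j < G)%N by rewrite ltn_divLR.
have jG' : (j.+1 * s <= G * s)%N by rewrite leq_pmul2r.
have ek' : (j.+1 * s)%N = (k + (s - q))%N.
  by rewrite ek -addnA subnKC// mulSn addnC.
have f1 : F (j * s)%N <= F k by rewrite ek; apply: Finc; rewrite -ek ltnW.
have f2 : F k <= F (j.+1 * s)%N by rewrite ek'; apply: Finc; rewrite -ek'.
have /andP[h1 h2] : 0 <= H k - H (j * s)%N <= c * q%:R by rewrite ek; apply: Hinc.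
have /andP[h3 h4] : 0 <= H (j.+1 * s)%N - H k <= c * (s - q)%:R by rewrite ek'; apply: Hinc.
have := FH j (ltnW jG); have := FH j.+1 jG.
have e1 : c * q%:R + c * (s - q)%:R = c * s%:R by rewrite -mulrDr -natrD subnKC.
rewrite !ler_norml => /andP[? ?] /andP[? ?].
by apply/andP; split; lra.
Qed.
End Grid.

Lemma measure_fin_le d (T : measurableType d) (R : realType)
    (mu : {measure set T -> \bar R}) (X : finType) (B : X -> set T) (v : R) :
  (forall a, measurable (B a) /\ (mu (B a) <= v%:E)%E) ->
  measurable [set x | exists a, B a x] /\ (mu [set x | exists a, B a x] <= (#|X|%:R * v)%:E)%E.
Proof.
move=> H.
have [] := @measure_seq_le _ _ _ mu X B (enum X) (fun=> v) (fun a _ => H a).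
rewrite big_enum/= sumr_const -[v *+ _]mulr_natl.
rewrite (_ : [set x | exists2 a, a \in enum X & B a x] = [set x | exists a, B a x])//.
by apply/seteqP; split => x [a]; [exists a|exists a; rewrite ?mem_enum].
Qed.

Lemma exists_expRX_le (R : realType) (eta de : R) : 0 < eta -> 0 < de ->
  exists J : nat, expR (- eta) ^+ J <= de.
Proof.
move=> e0 d0.
pose J := (Num.truncn (1 / (de * eta))).+1; exists J.
have h : 1 <= de * (J%:R * eta).
  have := truncnS_gt (1 / (de * eta)); rewrite ltr_pdivrMr ?mulr_gt0// => /ltW.
  by rewrite mulrCA.
rewrite -expRM_natl mulrN expRN invf_ple ?posrE ?expR_gt0//.
apply: le_trans (expR_ge1Dx _).
rewrite -[_^-1]mul1r ler_pdivrMr//; nra.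
Qed.

(** * Good paths and their coupling with words *)

Section GoodPaths.
Variables (R : realType) (Q eps : R) (N : nat) (l : R -> R) (N0 C L lam : R).
Hypotheses (eps_gt0 : 0 < eps) (N_gt0 : (0 < N)%N).
Hypotheses (N0_gt0 : 0 < N0) (C_gt0 : 0 < C) (L_gt0 : 0 < L) (lam_gt0 : 0 < lam).
Hypotheses (w_ge0 : forall i j, 0 <= @l_eps R Q eps N l i j)
  (w_diag : forall i, @l_eps R Q eps N l i i = 1).

Local Notation dep := (@dep_rate R Q eps N l N0 C L).
Local Notation total := (@total_rate R Q eps N l N0 C L lam).
Local Notation arr := (arr_rate eps lam).
Local Notation Y := (@jump_chain R Q eps N l N0 C L lam).
Local Notation Tm := (@jump_time R Q eps N l N0 C L lam).

Definition mean_clock (y0 : state N) (u : nat -> R) (k : nat) : R :=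
  \sum_(j < k) (total (Y y0 u j))^-1.
Definition mean_drift (y0 : state N) (u : nat -> R) (i : 'I_(N * N)) (k : nat) : R :=
  \sum_(j < k) (arr - dep (Y y0 u j) i) / total (Y y0 u j).

(** Nonnegative holding times at all indices make the jump index at a given time unique. Strict
    positivity below [n] ensures that each of these states is really occupied at some time. *)
Definition path_good (y0 : state N) (u : nat -> R) (z n : nat) (e : R) : Prop :=
  [/\ forall j, 0 <= - ln (u (2 * j)%N) /\ ((j < n)%N -> 0 < - ln (u (2 * j)%N)),
      forall k i, (k <= n)%N ->
        `|(Y y0 u k i)%:R - (y0 i)%:R - mean_drift y0 u i k| <= e * z%:R
    & forall k, (k <= n)%N -> `|Tm y0 u k - mean_clock y0 u k| <= e * z%:R].

Section Coupling.
Variables (d : measure_display) (T : measurableType d) (U : nat -> T -> R) (y0 : state N) (eta : R) (J : nat).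
Let pick := @chain_pick R Q eps N l N0 C L lam y0 eta J.
Local Notation hs k w := (hist U pick (2 * k) w).

(** The coupling is exact: rounding concerns the holding times only, on which the embedded chain
    does not depend. *)
Lemma hist_jump_chain k w : hist_state y0 (hs k w) = Y y0 (fun m => U m w) k.
Proof.
elim: k => [|k IH] //.
have E : (2 * k.+1 = (2 * k).+2)%N by rewrite mulnS.
rewrite E /=.
have -> : pick (hs k w) (U (2 * k)%N w) = inl (cell eta J (U (2 * k)%N w)).
  by rewrite /pick /chain_pick size_hist mul2n odd_double.
set a := inl _; rewrite {1}/pick {1}/chain_pick /= size_hist mul2n odd_double /=.
rewrite -mul2n IH /jump_step.
by case: (ohead _).
Qed.

Lemma hist_split k w : exists b c,
  hs k.+1 w = [:: inr b, inl c & hs k w] /\ c = cell eta J (U (2 * k)%N w).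
Proof.
have oh : odd (size (hs k w)) = false by rewrite size_hist mul2n odd_double.
rewrite mulnS /=; set h := hs k w in oh *.
have e1 v : pick h v = inl (cell eta J v) by rewrite /pick /chain_pick oh.
have e2 v c : exists b, pick (inl c :: h) v = inr b.
  by rewrite /pick /chain_pick /= oh /=; eexists.
rewrite e1; have [b ->] := e2 (U (2 * k).+1 w) (cell eta J (U (2 * k)%N w)).
by exists b, (cell eta J (U (2 * k)%N w)).
Qed.

Lemma odd_hs k w : odd (size (hs k w)) = false.
Proof. by rewrite size_hist mul2n odd_double. Qed.

Lemma hist_drift_sum i k w :
  hist_drift Q eps l N0 C L lam y0 i (hs k w) = mean_drift y0 (fun m => U m w) i k.
Proof.
elim: k => [|k IH]; first by rewrite /mean_drift big_ord0.
have [b [c [-> _]]] := hist_split k w.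
by rewrite /mean_drift big_ord_recr/= -/(mean_drift _ _ _ _) -IH odd_hs/= addr0 hist_jump_chain.
Qed.

Lemma time_mart_sum k w : time_mart Q eps l N0 C L lam y0 eta (hs k w) =
  \sum_(j < k) (eta * (cell eta J (U (2 * j)%N w))%:R - cell_mean eta J) / total (Y y0 (fun m => U m w) j).
Proof.
elim: k => [|k IH]; first by rewrite big_ord0.
have [b [c [-> ->]]] := hist_split k w.
by rewrite big_ord_recr/= -IH odd_hs/= addr0 hist_jump_chain.
Qed.

Lemma state_martE i k w : state_mart Q eps l N0 C L lam y0 i (hs k w) =
  (Y y0 (fun m => U m w) k i)%:R - (y0 i)%:R - mean_drift y0 (fun m => U m w) i k.
Proof. by rewrite /state_mart hist_jump_chain hist_drift_sum. Qed.

Lemma total_posV x : 0 < (total x)^-1.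
Proof. by rewrite invr_gt0; exact: total_rate_gt0. Qed.

Lemma mean_clock_le u k : 0 <= mean_clock y0 u k <= k%:R / arr.
Proof.
have a0 : 0 < arr by exact: arr_rate_gt0.
apply/andP; split; first by apply: sumr_ge0 => j _; rewrite ltW// total_posV.
rewrite mulr_natl -[X in _ *+ X]card_ord -sumr_const; apply: ler_sum => j _.
rewrite lef_pV2 ?posrE//; last exact: total_rate_gt0.
by have /andP[] : arr <= total (Y y0 u j) <= max_total eps N N0 C L lam by exact: total_rate_bnd.
Qed.

(** Off the residual cell a holding variable exceeds its rounding by at most [eta], and [cell_mean]
    lies in [1 - 2 eta, 1]; summed against the inverse rates, both errors are multiples of the
    clock. *)
Lemma jump_time_near k w : 0 < eta -> expR (- eta) ^+ J <= eta ->
  (forall j, (j < k)%N -> expR (- eta) ^+ J <= U (2 * j)%N w < 1) ->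
  `|Tm y0 (fun m => U m w) k - mean_clock y0 (fun m => U m w) k| <=
    `|time_mart Q eps l N0 C L lam y0 eta (hs k w)| + 2 * eta * mean_clock y0 (fun m => U m w) k.
Proof.
move=> e0 rJ HU.
have [/andP[m1 m2] _] := @cell_mean_bnd R Q eps N l N0 C L lam eps_gt0 N_gt0 N0_gt0 C_gt0
  L_gt0 lam_gt0 w_ge0 w_diag y0 eta J e0 rJ.
set u := fun m => U m w; set tm := time_mart _ _ _ _ _ _ _ _ _ _; set mm := cell_mean eta J in m1 m2.
have /andP[c0 _] := mean_clock_le u k.
have lo : tm + mm * mean_clock y0 u k <= Tm y0 u k <= tm + (mm + eta) * mean_clock y0 u k.
  rewrite /tm time_mart_sum /mean_clock !mulr_sumr -!big_split/= /jump_time.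
  apply/andP; split; apply: ler_sum => j _.
    rewrite -mulrDl subrK ler_pM2r ?total_posV//.
    by have [_ /andP[]] := cell_ln (HU j (ltn_ord j)).
  rewrite -mulrDl addrA subrK ler_pM2r ?total_posV//.
  by have [_ /andP[]] := cell_ln (HU j (ltn_ord j)).
have /andP[l1 l2] := lo.
have := ler_norm tm; have := ler_norm (- tm); rewrite normrN => n1 n2.
have k1 : 0 <= (mm - (1 - 2 * eta)) * mean_clock y0 u k by rewrite mulr_ge0// subr_ge0.
have k2 : 0 <= (1 - mm) * mean_clock y0 u k by rewrite mulr_ge0// subr_ge0.
have k3 : 0 <= eta * mean_clock y0 u k by rewrite mulr_ge0// ltW.
by rewrite ler_norml; apply/andP; split; lra.
Qed.
End Coupling.
End GoodPaths.

Section GoodProbability.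
Variables (R : realType) (Q eps : R) (N : nat) (l : R -> R) (N0 C L lam : R).
Hypotheses (eps_gt0 : 0 < eps) (N_gt0 : (0 < N)%N).
Hypotheses (N0_gt0 : 0 < N0) (C_gt0 : 0 < C) (L_gt0 : 0 < L) (lam_gt0 : 0 < lam).
Hypotheses (w_ge0 : forall i j, 0 <= @l_eps R Q eps N l i j)
  (w_diag : forall i, @l_eps R Q eps N l i i = 1).
Variables (d : measure_display) (T : measurableType d) (P : probability T R).
Variables (U : nat -> T -> R) (hU : iid_uniform01 P U).

Local Notation arr := (arr_rate eps lam).
Local Notation good := (@path_good R Q eps N l N0 C L lam).

Lemma uniform_exit (a : R) k : 0 <= a -> a <= 1 ->
  measurable [set w | ~ (a <= U k w < 1)] /\ (P [set w | ~ (a <= U k w < 1)%R] <= a%:E)%E.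
Proof.
move=> a0 a1; have [mU [uU _]] := hU.
have E : [set w | ~ (a <= U k w < 1)] = ~` (U k @^-1` `[a, 1[%classic).
  by apply/seteqP; split => w /=; rewrite in_itv.
have mA : measurable (U k @^-1` `[a, 1[%classic).
  by rewrite -[_ @^-1` _]setTI; apply: mU.
rewrite E; split; first exact: measurableC.
rewrite probability_setC// uU// setIidl.
  rewrite lebesgue_measure_itv/= lte_fin; case: ifPn => [_|].
    by rewrite -!EFinD lee_fin; lra.
  by rewrite -leNgt => h; rewrite -EFinB lee_fin; lra.
move=> u /=; rewrite !in_itv/= => /andP[h1 h2].
by rewrite (le_trans a0 h1) ltW.
Qed.

(** One null event that covers all indices, outside of which every [- ln (U k)] is nonnegative. *)
Lemma uniform_gt1 : exists B : set T, [/\ measurable B, P B = 0%E &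
  forall k w, 1 < U k w -> B w].
Proof.
have [mU [uU _]] := hU.
have H : P.-negligible (\bigcup_k (U k @^-1` `]1, +oo[%classic)).
  apply: negligible_bigcup => k; exists (U k @^-1` `]1, +oo[%classic); split => //.
    by rewrite -[_ @^-1` _]setTI; apply: mU.
  apply: etrans (uU k _ (measurable_itv _)) _.
  rewrite (_ : _ `&` _ = set0) ?measure0//.
  apply/seteqP; split => // u /=; rewrite !in_itv/= andbT => -[h1 /andP[_ h2]].
  by have := lt_le_trans h1 h2; rewrite ltxx.
have [B [mB B0 sB]] := H; exists B; split => // k w h.
by apply: sB; exists k => //=; rewrite in_itv/= h.
Qed.

(** The grid has a number of points independent of [z]; at each, a variance of order z against a
    deviation of order z gives a probability O(1/z). The constants are uniform in the initial
    state. *)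
Theorem good_prob (m : nat) (e : R) : 0 < e ->
  exists (K : R) (z0 : nat), forall z, (z0 <= z)%N -> forall y0 : state N,
    exists B : set T, [/\ measurable B, (P B <= (K / z%:R)%:E)%E &
      forall w, ~ B w -> good y0 (fun k => U k w) z (m * z) e].
Proof.
move=> e0.
have a0 : 0 < arr by exact: arr_rate_gt0.
have ia0 : 0 < arr^-1 by rewrite invr_gt0.
(* One jump is two letters, each changing [state_mart] by at most 2; [arr^-1] bounds one step of the
   mean clock. *)
pose c : R := 4 + arr^-1.
have c0 : 0 < c by rewrite addr_gt0.
(* The grid spacing [s] is about z / M, chosen so that [c * s <= e * z / 4]; [G] steps of it cover
   [m * z] jumps. *)
pose M := (Num.truncn (8 * c / e)).+1.
have M0 : 0 < M%:R :> R by rewrite ltr0n.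
have cM : c * 8 <= e * M%:R.
  have := truncnS_gt (8 * c / e); rewrite -/M ltr_pdivrMr// => /ltW.
  by rewrite mulrC [e * _]mulrC.
pose G := (m * M).+1.
have G0 : 0 < G%:R :> R by rewrite ltr0n.
(* The rounding bias [2 * eta * clock] is then at most [e * z / 4], since the clock is at most
   [2 * G * z / arr] on the grid. *)
pose eta : R := e * arr / (16 * G%:R).
have eta0 : 0 < eta by rewrite divr_gt0// mulr_gt0.
pose r := expR (- eta).
have r0 : 0 < r by exact: expR_gt0.
pose V : R := 2 * eta ^+ 2 / (1 - r) ^+ 2 / arr ^+ 2.
have V0 : 0 <= V by rewrite divr_ge0 ?sqr_ge0// divr_ge0 ?sqr_ge0// mulr_ge0// sqr_ge0.
pose X1 : finType := ('I_G.+1 * 'I_(N * N))%type.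
pose X2 : finType := 'I_G.+1.
pose K1 : R := (#|X1|%:R * (64 * G%:R) + #|X2|%:R * (64 * G%:R * V)) / e ^+ 2.
have e20 : 0 < e ^+ 2 by rewrite exprn_gt0.
exists (K1 + 1), (maxn M 1) => z.
rewrite geq_max => /andP[Mz z0] y0.
have zR : 0 < z%:R :> R by rewrite ltr0n.
pose s := (z %/ M).+1.
have sM : (s * M <= 2 * z)%N.
  by rewrite /s mulSn mul2n -addnn leq_add// leq_divM.
have sz : (s <= 2 * z)%N by apply: leq_trans sM; rewrite leq_pmulr.
have mG : (m * z < G * s)%N.
  rewrite /G mulSn -addn1 addnC leq_add// -mulnA leq_mul//.
  by rewrite ltnW// mulnC ltn_ceil.
have cs : c * s%:R <= e * z%:R / 4.
  rewrite -(ler_pM2r M0).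
  have h1 : s%:R * M%:R <= 2 * z%:R :> R by rewrite -!natrM ler_nat.
  have h2 : c * (s%:R * M%:R) <= c * (2 * z%:R) by rewrite ler_wpM2l// ltW.
  have h3 : c * 8 * z%:R <= e * M%:R * z%:R by rewrite ler_wpM2r.
  lra.
(* [J] may depend on [z]: the third bound makes the [G * s] residual events have total probability
   at most 1 / z. *)
have de0 : 0 < Num.min eta (Num.min 1 (1 / ((G * s)%N%:R * z%:R))).
  by rewrite !lt_min eta0 ltr01 divr_gt0// mulr_gt0// ltr0n muln_gt0.
have [J HJ] := @exists_expRX_le R eta (Num.min eta (Num.min 1 (1 / ((G * s)%N%:R * z%:R)))) eta0
   de0.
rewrite -/r !le_min in HJ; case/and3P: HJ => HJ1 HJ2 HJ3.
pose pick := @chain_pick R Q eps N l N0 C L lam y0 eta J.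
pose hs k w := hist U pick (2 * k) w.
pose sm i w k := state_mart Q eps l N0 C L lam y0 i (hs k w).
pose tm w k := time_mart Q eps l N0 C L lam y0 eta (hs k w).
have mp : forall h a, measurable (pick h @^-1` [set a]).
  by move=> h a; apply: measurable_chain_pick.
pose B1 (x : X1) := [set w | e * z%:R / 2 <= `|sm x.2 w (x.1 * s)%N|].
pose B2 (x : X2) := [set w | e * z%:R / 4 <= `|tm w (x * s)%N|].
pose B3 (x : 'I_(G * s)) := [set w | ~ (r ^+ J <= U (2 * x)%N w < 1)].
have jz (j : 'I_G.+1) : (2 * (j * s))%N%:R <= 4 * G%:R * z%:R :> R.
  have : (2 * (j * s) <= 4 * G * z)%N.
    by rewrite -mulnA -[4%N]/(2 * 2)%N -mulnA leq_mul2l/= mulnCA leq_mul// -ltnS.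
  by rewrite -(ler_nat R) !natrM.
have H1 x : measurable (B1 x) /\ (P (B1 x) <= (64 * G%:R / e ^+ 2 / z%:R)%:E)%E.
  have b0 : 0 < e * z%:R / 2 by rewrite divr_gt0// mulr_gt0.
  have F0 : state_mart Q eps l N0 C L lam y0 x.2 ([::] : seq ('I_J.+1 + option ('I_(N * N) * bool))) = 0.
    by rewrite /state_mart /= subrr subr0.
  have F1 h : \sum_a prob pick h a * (state_mart Q eps l N0 C L lam y0 x.2 (a :: h)
      - state_mart Q eps l N0 C L lam y0 x.2 h) = 0 by apply: state_mart_mean.
  have F2 h : \sum_a prob pick h a * (state_mart Q eps l N0 C L lam y0 x.2 (a :: h)
      - state_mart Q eps l N0 C L lam y0 x.2 h) ^+ 2 <= 4 by apply: state_mart_var.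
  have [m1 m2] := @hist_chebyshev R d T P U hU _ pick mp (state_mart Q eps l N0 C L lam y0 x.2)
    4 (2 * (x.1 * s)) _ F0 F1 F2 b0.
  split => //; apply: le_trans m2 _; rewrite lee_fin ler_pdivrMr ?exprn_gt0//.
  have -> : 64 * G%:R / e ^+ 2 / z%:R * (e * z%:R / 2) ^+ 2 = 4 * G%:R * z%:R * 4.
    by field; rewrite !gt_eqF.
  by rewrite ler_pM2r.
have H2 x : measurable (B2 x) /\ (P (B2 x) <= (64 * G%:R * V / e ^+ 2 / z%:R)%:E)%E.
  have b0 : 0 < e * z%:R / 4 by rewrite divr_gt0// mulr_gt0.
  have F1 h : \sum_a prob pick h a * (time_mart Q eps l N0 C L lam y0 eta (a :: h)
      - time_mart Q eps l N0 C L lam y0 eta h) = 0 by apply: time_mart_mean.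
  have F2 h : \sum_a prob pick h a * (time_mart Q eps l N0 C L lam y0 eta (a :: h)
      - time_mart Q eps l N0 C L lam y0 eta h) ^+ 2 <= V by apply: time_mart_var.
  have [m1 m2] := @hist_chebyshev R d T P U hU _ pick mp (time_mart Q eps l N0 C L lam y0 eta (J:=J))
    V (2 * (x * s)) _ erefl F1 F2 b0.
  split => //; apply: le_trans m2 _; rewrite lee_fin ler_pdivrMr ?exprn_gt0//.
  have -> : 64 * G%:R * V / e ^+ 2 / z%:R * (e * z%:R / 4) ^+ 2 = 4 * G%:R * z%:R * V.
    by field; rewrite !gt_eqF.
  by rewrite ler_wpM2r.
have H3 x : measurable (B3 x) /\ (P (B3 x) <= (r ^+ J)%:E)%E.
  by apply: uniform_exit => //; rewrite exprn_ge0// ltW.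
have [m1 p1] := measure_fin_le H1.
have [m2 p2] := measure_fin_le H2.
have [m3 p3] := measure_fin_le H3.
have [B4 [m4 p4 nB4]] := uniform_gt1.
exists ([set w | exists x, B1 x w] `|` [set w | exists x, B2 x w] `|` [set w | exists x, B3 x w] `|` B4).
have m12 := measurableU _ _ m1 m2.
have m123 := measurableU _ _ m12 m3.
split.
- exact: measurableU.
- apply: (le_trans (measureU2 _ m123 m4)).
  have p4' : (P B4 <= 0%:E)%E by rewrite p4.
  apply: (le_trans (leeD (le_trans (measureU2 _ m12 m3)
    (leeD (le_trans (measureU2 _ m1 m2) (leeD p1 p2)) p3)) p4')).
  rewrite -!EFinD lee_fin addr0 [X in _ <= X]mulrDl lerD//.
    rewrite /K1 le_eqVlt; apply/orP; left; apply/eqP.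
    by field; rewrite !gt_eqF.
  rewrite card_ord; have Gs0 : 0 < (G * s)%N%:R :> R by rewrite ltr0n muln_gt0.
  move: HJ3; rewrite !ler_pdivlMr ?mulr_gt0//; lra.
move=> w nB.
have N1 (x : X1) : `|sm x.2 w (x.1 * s)%N| < e * z%:R / 2.
  by rewrite ltNge; apply/negP => h; apply: nB; left; left; left; exists x.
have N2 (x : X2) : `|tm w (x * s)%N| < e * z%:R / 4.
  by rewrite ltNge; apply/negP => h; apply: nB; left; left; right; exists x.
have N3 j : (j < G * s)%N -> r ^+ J <= U (2 * j)%N w < 1.
  move=> jG; apply: contrapT => h; apply: nB; left; right.
  by exists (Ordinal jG).
have ez0 : 0 < e * z%:R by rewrite mulr_gt0.
split.
- move=> j; split => [|jm]; last by have [] := cell_ln (N3 j (ltn_trans jm mG)).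
  rewrite oppr_ge0; apply: ln_le0; rewrite leNgt; apply/negP => h.
  by apply: nB; right; exact: nB4 h.
- move=> k i km.
  rewrite -(@state_martE R Q eps N l N0 C L lam d T U y0 eta J).
  have := @grid_bound R (sm i w) 4 (e * z%:R / 2) s G isT _ _ k (leq_trans km (ltnW mG)).
  move=> /(_ _ _)/le_trans; apply.
  + move=> k'; rewrite /sm /hs mulnS /=.
    set a := pick _ _; set b := pick _ _; set h := hist _ _ _ _.
    have -> : state_mart Q eps l N0 C L lam y0 i [:: a, b & h] - state_mart Q eps l N0 C L lam y0 i h =
      (state_mart Q eps l N0 C L lam y0 i [:: a, b & h] - state_mart Q eps l N0 C L lam y0 i (b :: h))
      + (state_mart Q eps l N0 C L lam y0 i (b :: h) - state_mart Q eps l N0 C L lam y0 i h) by ring.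
    rewrite (le_trans (ler_normD _ _))// (_ : 4 = 2 + 2) ?lerD ?state_mart_step_le//.
    by rewrite -natrD.
  + move=> j jG; have jG' : (j < G.+1)%N by [].
    by have := N1 (Ordinal jG', i) => /= /ltW.
  + have : 4 * s%:R <= c * s%:R by rewrite ler_wpM2r// lerDl ltW.
    lra.
- move=> k km.
  have kG : (k < G * s)%N := leq_ltn_trans km mG.
  have := @grid_mono R (@jump_time R Q eps N l N0 C L lam y0 (fun k => U k w))
    (mean_clock Q eps l N0 C L lam y0 (fun k => U k w)) arr^-1 (e * z%:R / 4 + e * z%:R / 4) s G isT _ _ _ k kG.
  move=> /(_ _ _ _)/le_trans; apply.
  + move=> k' k'G; rewrite /jump_time big_ord_recr/= lerDl mulr_ge0//.
      by have [/ltW] := cell_ln (N3 k' k'G).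
    by rewrite ltW// total_posV.
  + move=> k'; rewrite /mean_clock big_ord_recr/= addrAC subrr add0r.
    rewrite ltW ?total_posV//= lef_pV2 ?posrE//; last exact: total_rate_gt0.
    by have /andP[] : arr <= total_rate Q eps l N0 C L lam (jump_chain Q eps l N0 C L lam y0 (fun k => U k w) k')
      <= max_total eps N N0 C L lam by exact: total_rate_bnd.
  + move=> j jG; have jG' : (j < G.+1)%N by [].
    have jsG : (j * s <= G * s)%N by rewrite leq_mul2r jG orbT.
    have := @jump_time_near R Q eps N l N0 C L lam eps_gt0 N_gt0 N0_gt0 C_gt0 L_gt0 lam_gt0 w_ge0 w_diag
      d T U y0 eta J (j * s)%N w eta0 HJ1 (fun j' h => N3 j' (leq_trans h jsG)).
    move=> /le_trans; apply; apply: lerD; first exact: ltW (N2 (Ordinal jG')).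
    have /andP[_ h] := @mean_clock_le R Q eps N l N0 C L lam eps_gt0 N_gt0 N0_gt0 C_gt0 L_gt0 lam_gt0 w_ge0 w_diag
      y0 (fun k => U k w) (j * s)%N.
    have h' : (j * s)%N%:R / arr <= (2 * G * z)%N%:R / arr.
      rewrite ler_pM2r// ler_nat (leq_trans jsG)//.
      by rewrite mulnAC [(2 * z * G)%N]mulnC leq_mul.
    have e2 : 0 <= 2 * eta by rewrite mulr_ge0// ltW.
    apply: (le_trans (ler_wpM2l e2 (le_trans h h'))).
    rewrite !natrM /eta le_eqVlt; apply/orP; left; apply/eqP.
    by field; rewrite !gt_eqF.
  + have : arr^-1 * s%:R <= c * s%:R by rewrite ler_wpM2r// lerDr.
    lra.
Qed.
End GoodProbability.

(** * From jump times to real time *)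

Lemma sum_ord_diff (R : zmodType) (f : nat -> R) (p q : nat) : (p <= q)%N ->
  \sum_(j < q) f j - \sum_(j < p) f j = \sum_(p <= j < q) f j.
Proof.
move=> pq; rewrite -!(big_mkord xpredT f) (big_cat_nat (leq0n p) pq)//=.
by rewrite addrAC subrr add0r.
Qed.

Section PathEstimates.
Variables (R : realType) (Q eps : R) (N : nat) (l : R -> R) (N0 C L lam : R).
Hypotheses (eps_gt0 : 0 < eps) (N_gt0 : (0 < N)%N).
Hypotheses (N0_gt0 : 0 < N0) (C_gt0 : 0 < C) (L_gt0 : 0 < L) (lam_gt0 : 0 < lam).
Hypotheses (w_ge0 : forall i j, 0 <= @l_eps R Q eps N l i j)
  (w_diag : forall i, @l_eps R Q eps N l i i = 1).

Local Notation dep := (@dep_rate R Q eps N l N0 C L).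
Local Notation total := (@total_rate R Q eps N l N0 C L lam).
Local Notation arr := (arr_rate eps lam).
Local Notation dmax := (max_dep N0 C L).

Variables (y : state N) (u : nat -> R).
Local Notation Y := (@jump_chain R Q eps N l N0 C L lam y u).
Local Notation Tm := (@jump_time R Q eps N l N0 C L lam y u).
Local Notation clock := (@mean_clock R Q eps N l N0 C L lam y u).

Definition jump_index (t : R) : nat := xget 0%N [set k | Tm k <= t < Tm k.+1].

(** The compensator of the scaled departures, not their count: each jump adds its conditional
    probability of being a departure from [i]. *)
Definition departed (z : nat) (i : 'I_(N * N)) (t : R) : R :=
  z%:R^-1 * \sum_(j < jump_index (z%:R * t)) dep (Y j) i / total (Y j).

Hypothesis exp_ge0 : forall j, 0 <= - ln (u (2 * j)%N).

Lemma jump_time_mono p q : (p <= q)%N -> Tm p <= Tm q.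
Proof.
move=> pq; rewrite -subr_ge0 /jump_time.
rewrite (sum_ord_diff (fun m => - ln (u (2 * m)%N) / total (Y m)) pq).
by apply: sumr_ge0 => j _; rewrite mulr_ge0// ltW// total_posV.
Qed.

Lemma jump_index_eq k t : Tm k <= t < Tm k.+1 -> jump_index t = k.
Proof.
move=> kt; have /andP[k1 k2] := kt.
have /andP[h1 h2] : Tm (jump_index t) <= t < Tm (jump_index t).+1.
  by apply: (@xgetPex _ 0%N [set k | Tm k <= t < Tm k.+1]); exists k.
apply/eqP; rewrite eqn_leq; apply/andP; split; rewrite leqNgt; apply/negP => lt.
  have := le_lt_trans h1 k2; rewrite ltNge; move/negP; apply; exact: jump_time_mono.
have := le_lt_trans k1 h2; rewrite ltNge; move/negP; apply; exact: jump_time_mono.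
Qed.

Lemma jump_indexP n t : 0 <= t -> t < Tm n ->
  (jump_index t < n)%N /\ Tm (jump_index t) <= t < Tm (jump_index t).+1.
Proof.
move=> t0 tn.
have ex : exists k, t < Tm k by exists n.
case: (ex_minnP ex) => k tk kmin.
case: k => [|k] in tk kmin *.
  by move: tk; rewrite /jump_time big_ord0 => /(le_lt_trans t0); rewrite ltxx.
have kt : Tm k <= t < Tm k.+1.
  by rewrite tk andbT leNgt; apply/negP => /kmin; rewrite ltnn.
by rewrite (jump_index_eq kt); split => //; exact: kmin.
Qed.

Variables (z n : nat) (e h : R).
Hypothesis good : path_good Q eps l N0 C L lam y u z n e.
Hypotheses (z_gt0 : (0 < z)%N) (h_lt : z%:R * h < Tm n).

Let zR : 0 < z%:R :> R. Proof. by rewrite ltr0n. Qed.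
Let a0 : 0 < arr. Proof. exact: arr_rate_gt0. Qed.
(** The second term is one step of the mean clock, since real time falls between two consecutive
    jumps. *)
Let err : R := 3 * e + 1 / (arr * z%:R).

Let indexP t : 0 <= t <= h -> (jump_index (z%:R * t) < n)%N /\
  Tm (jump_index (z%:R * t)) <= z%:R * t < Tm (jump_index (z%:R * t)).+1.
Proof.
move=> /andP[t0 th]; apply: jump_indexP; first by rewrite mulr_ge0// ltW.
by apply: le_lt_trans h_lt; rewrite ler_pM2l.
Qed.

Lemma clock_near t : 0 <= t <= h -> `|clock (jump_index (z%:R * t)) - z%:R * t| <= z%:R * err.
Proof.
move=> th; have [kn /andP[k1 k2]] := indexP th.
set k := jump_index _ in kn k1 k2 *.
have [_ _ HT] := good.
have := HT k (ltnW kn); have := HT k.+1 kn.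
have aa := a0; have zz := zR.
have inc : clock k.+1 - clock k <= arr^-1.
  rewrite /mean_clock big_ord_recr/= addrAC subrr add0r.
  rewrite lef_pV2 ?posrE//; last exact: total_rate_gt0.
  by have /andP[] : arr <= total (Y k) <= max_total eps N N0 C L lam by exact: total_rate_bnd.
have -> : z%:R * err = 3 * (e * z%:R) + arr^-1.
  by rewrite /err; field; rewrite !gt_eqF.
rewrite !ler_norml => /andP[? ?] /andP[? ?].
by apply/andP; split; lra.
Qed.

Lemma path_balance i t : 0 <= t <= h ->
  `|(Y (jump_index (z%:R * t)) i)%:R / z%:R - ((y i)%:R / z%:R + arr * t - departed z i t)|
    <= e + arr * err.
Proof.
move=> th; have [kn _] := indexP th; have := clock_near th.
rewrite /departed; set k := jump_index _ in kn *.
have [_ HY _] := good; have := HY k i (ltnW kn).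
have aa := a0; have zz := zR.
have -> : mean_drift Q eps l N0 C L lam y u i k =
    arr * clock k - \sum_(j < k) dep (Y j) i / total (Y j).
  rewrite /mean_drift /mean_clock mulr_sumr -sumrB; apply: eq_bigr => j _.
  by rewrite mulrBl.
set S := \sum_(j < k) _ => h1 h2.
have -> : (Y k i)%:R / z%:R - ((y i)%:R / z%:R + arr * t - z%:R^-1 * S) =
   z%:R^-1 * (((Y k i)%:R - (y i)%:R - (arr * clock k - S)) + arr * (clock k - z%:R * t)).
  by field; rewrite gt_eqF.
rewrite normrM gtr0_norm ?invr_gt0// ler_pdivrMl//.
rewrite (le_trans (ler_normD _ _))// [X in _ <= X]mulrDr lerD//; first by rewrite [_%:R * e]mulrC.
by rewrite normrM (gtr0_norm aa) mulrCA ler_pM2l.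
Qed.

Lemma dep_bnd k i : 0 <= dep (Y k) i <= dmax.
Proof. exact: dep_rate_bnd. Qed.

Lemma departed_init i : 0 <= h -> `|departed z i 0| <= dmax * err.
Proof.
move=> h0; have := @clock_near 0; rewrite lexx h0 mulr0 subr0 => /(_ isT).
have zz := zR; rewrite /departed mulr0; set k := jump_index _ => H.
have S0 : 0 <= \sum_(j < k) dep (Y j) i / total (Y j).
  apply: sumr_ge0 => j _; apply: mulr_ge0; first by have /andP[] := dep_bnd j i.
  by rewrite ltW// total_posV.
rewrite ger0_norm ?mulr_ge0 ?invr_ge0 ?(ltW zz)// ler_pdivrMl//.
have d0 : 0 <= dmax by exact: max_dep_ge0.
rewrite mulrCA; apply: (@le_trans _ _ (dmax * clock k)).
  rewrite /mean_clock mulr_sumr; apply: ler_sum => j _.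
  by rewrite ler_pM2r ?total_posV//; have /andP[] := dep_bnd j i.
by rewrite ler_wpM2l// (le_trans (ler_norm _)).
Qed.

(** Each summand is a departure rate times a step of the mean clock, and the clock advances by
    [z * (t - s)] up to [2 * z * err]. *)
Lemma departed_incr i s t al be : 0 <= s -> s <= t -> t <= h ->
  (forall r, s <= r <= t -> al <= dep (Y (jump_index (z%:R * r))) i <= be) ->
  al * (t - s) - 2 * dmax * err <= departed z i t - departed z i s <= be * (t - s) + 2 * dmax * err.
Proof.
move=> s0 st th Hr.
have sh : 0 <= s <= h by rewrite s0 (le_trans st).
have th' : 0 <= t <= h by rewrite th (le_trans s0).
have d0 : 0 <= dmax by exact: max_dep_ge0.
have [Eexp _ _] := good.
have [ns /andP[s1 s2]] := indexP sh; have [nt /andP[t1 t2]] := indexP th'.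
have := clock_near sh; have := clock_near th'.
rewrite /departed -mulrBr.
set p := jump_index (z%:R * s) in ns s1 s2 *; set q := jump_index (z%:R * t) in nt t1 t2 *.
have pq : (p <= q)%N.
  rewrite leqNgt; apply/negP => qp.
  have h1 := jump_time_mono qp.
  have : z%:R * s <= z%:R * t by rewrite ler_pM2l.
  move: (lt_le_trans t2 (le_trans h1 s1)) => h2 h3.
  by have := lt_le_trans h2 h3; rewrite ltxx.
move=> ct cs.
have zz := zR.
(* The hypothesis speaks of real times, the sum of jump indices. For [j > p] the state [Y j] is
   current at time [Tm j / z] in [s, t], by positivity of its holding time; state [p] is current at
   [s]. *)
have Hj j : (p <= j < q)%N -> al <= dep (Y j) i <= be.
  move=> /andP[pj jq].
  have [jp|pj'] := leqP j p.
    have -> : j = p by apply/eqP; rewrite eqn_leq jp pj.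
    by apply: Hr; rewrite lexx st.
  have jn : (j < n)%N := ltn_trans jq nt.
  have E0 := (Eexp j).2 jn.
  have jlt : Tm j < Tm j.+1.
    by rewrite /jump_time big_ord_recr/= ltrDl mulr_gt0// total_posV.
  have jE : jump_index (z%:R * (Tm j / z%:R)) = j.
    have -> : z%:R * (Tm j / z%:R) = Tm j by field; rewrite gt_eqF.
    by apply: jump_index_eq; rewrite lexx.
  have := Hr (Tm j / z%:R); rewrite jE; apply; apply/andP; split.
    rewrite ler_pdivlMr// mulrC ltW//; apply: (lt_le_trans s2).
    exact: jump_time_mono.
  rewrite ler_pdivrMr// mulrC; apply: le_trans t1; apply: jump_time_mono.
  exact: ltnW.
have Sdiff := sum_ord_diff (fun j => dep (Y j) i / total (Y j)) pq; rewrite Sdiff.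
have Cdiff : clock q - clock p = \sum_(p <= j < q) (total (Y j))^-1.
  exact: (sum_ord_diff (fun j => (total (Y j))^-1) pq).
(* Clipping [al] and [be] to [0, dmax] bounds the clock error by a multiple of [dmax], whatever
   their values. *)
have al1 : al <= Num.max al 0 by rewrite le_max lexx.
have al2 : 0 <= Num.max al 0 by rewrite le_max lexx orbT.
have be1 : Num.min be dmax <= be by rewrite ge_min lexx.
have be2 : Num.min be dmax <= dmax by rewrite ge_min lexx orbT.
have Hs : al <= dep (Y p) i <= be by apply: Hr; rewrite lexx st.
have al3 : Num.max al 0 <= dmax.
  rewrite ge_max d0 andbT; have /andP[h1 _] := Hs; apply: (le_trans h1).
  by have /andP[] := dep_bnd p i.
have be3 : 0 <= Num.min be dmax.
  rewrite le_min d0 andbT; have /andP[_ h1] := Hs; apply: le_trans h1.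
  by have /andP[] := dep_bnd p i.
have lo : Num.max al 0 * (clock q - clock p) <= \sum_(p <= j < q) dep (Y j) i / total (Y j).
  rewrite Cdiff mulr_sumr; apply: ler_sum_nat => j pjq.
  rewrite ler_pM2r ?total_posV// ge_max; have /andP[-> _] := Hj j pjq.
  by have /andP[] := dep_bnd j i.
have hi : \sum_(p <= j < q) dep (Y j) i / total (Y j) <= Num.min be dmax * (clock q - clock p).
  rewrite Cdiff mulr_sumr; apply: ler_sum_nat => j pjq.
  rewrite ler_pM2r ?total_posV// le_min; have /andP[_ ->] := Hj j pjq.
  by have /andP[] := dep_bnd j i.
move: ct cs; rewrite !ler_norml => /andP[c1 c2] /andP[c3 c4].
have e0 : 0 <= z%:R * err by lra.
have ts0 : 0 <= t - s by rewrite subr_ge0.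
set S := \sum_(p <= j < q) _ in lo hi *.
set al' := Num.max al 0 in al1 al2 al3 lo; set be' := Num.min be dmax in be1 be2 be3 hi.
have cl : z%:R * (t - s) - 2 * (z%:R * err) <= clock q - clock p by lra.
have ch : clock q - clock p <= z%:R * (t - s) + 2 * (z%:R * err) by lra.
apply/andP; split.
  rewrite ler_pdivlMl//; apply: le_trans lo.
  apply: (@le_trans _ _ (al' * (z%:R * (t - s) - 2 * (z%:R * err)))); last by rewrite ler_wpM2l.
  have k1 : al * (z%:R * (t - s)) <= al' * (z%:R * (t - s)) by rewrite ler_wpM2r// mulr_ge0// ltW.
  have k2 : al' * (z%:R * err) <= dmax * (z%:R * err) by rewrite ler_wpM2r.
  lra.
rewrite ler_pdivrMl//; apply: (le_trans hi).
apply: (@le_trans _ _ (be' * (z%:R * (t - s) + 2 * (z%:R * err)))); first by rewrite ler_wpM2l.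
have k1 : be' * (z%:R * (t - s)) <= be * (z%:R * (t - s)) by rewrite ler_wpM2r// mulr_ge0// ltW.
have k2 : be' * (z%:R * err) <= dmax * (z%:R * err) by rewrite ler_wpM2r.
lra.
Qed.
End PathEstimates.

(** * Fluid limits of sequences of good paths *)

Section LimitOfPaths.
Variables (R : realType) (Q eps : R) (N : nat) (l : R -> R) (N0 C L lam : R).
Hypotheses (eps_gt0 : 0 < eps) (N_gt0 : (0 < N)%N).
Hypotheses (N0_gt0 : 0 < N0) (C_gt0 : 0 < C) (L_gt0 : 0 < L) (lam_gt0 : 0 < lam).
Local Notation w := (@l_eps R Q eps N l).
Hypotheses (w_ge0 : forall i j, 0 <= w i j) (w_diag : forall i, w i i = 1).
Hypothesis w_le1 : forall i j, w i j <= 1.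
Hypothesis w_connected : forall Z : pred 'I_(N * N), (exists i, Z i) ->
  (forall i k, Z i -> w i k = 1 -> Z k) -> forall k, Z k.

Local Notation dep := (@dep_rate R Q eps N l N0 C L).
Local Notation arr := (arr_rate eps lam).
Local Notation dmax := (max_dep N0 C L).
Local Notation qmax := (max_total eps N N0 C L lam).

Definition tolerance (m : nat) : R := m.+1%:R^-1.
(** After [horizon m * z] jumps the mean clock is at least z (m + 2), and the tolerance takes away
    at most z, so real time z m is passed. *)
Definition horizon (m : nat) : nat := (Num.truncn (qmax * (m%:R + 2))).+1.

Lemma tolerance_gt0 m : 0 < tolerance m.
Proof. by rewrite invr_gt0 ltr0n. Qed.

Lemma sup_norm_ge n (v : 'I_n -> R) i : `|v i| <= sup_norm v.
Proof. by rewrite /sup_norm; apply: (le_bigmax_cond _ (fun i => `|v i|)). Qed.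

Lemma sup_norm_le n (v : 'I_n -> R) b : 0 <= b -> (forall i, `|v i| <= b) -> sup_norm v <= b.
Proof. by move=> b0 vb; apply: bigmax_le. Qed.

Lemma jump_time_horizon (y : state N) (u : nat -> R) (z m : nat) : (0 < z)%N ->
  path_good Q eps l N0 C L lam y u z (horizon m * z) (tolerance m) ->
  z%:R * m%:R < jump_time Q eps l N0 C L lam y u (horizon m * z).
Proof.
move=> z0 [_ _ /(_ _ (leqnn _))].
have zR : 0 < z%:R :> R by rewrite ltr0n.
have q0 : 0 < qmax.
  have /andP[h1 h2] : arr <= total_rate Q eps l N0 C L lam y <= qmax by exact: total_rate_bnd.
  by apply: lt_le_trans h2; apply: lt_le_trans h1; exact: arr_rate_gt0.
set n := (horizon m * z)%N => H.
have ck : n%:R / qmax <= mean_clock Q eps l N0 C L lam y u n.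
  rewrite mulr_natl -[X in _ *+ X]card_ord -sumr_const; apply: ler_sum => j _.
  rewrite lef_pV2 ?posrE//; last exact: total_rate_gt0.
  by have /andP[] : arr <= total_rate Q eps l N0 C L lam (jump_chain Q eps l N0 C L lam y u j) <= qmax
    by exact: total_rate_bnd.
have nq : z%:R * (m%:R + 2) <= n%:R / qmax.
  have hq : qmax * (m%:R + 2) <= (horizon m)%:R by exact: ltW (truncnS_gt _).
  rewrite ler_pdivlMr// /n natrM.
  have := ler_wpM2r (ltW zR) hq; lra.
have t1 : tolerance m * z%:R <= z%:R.
  by rewrite ler_piMl ?(ltW zR)// invf_le1 ?ltr0n// ler1n.
by move: H; rewrite ler_norml => /andP[? ?]; lra.
Qed.

Variables (x0 : 'I_(N * N) -> R) (y : nat -> state N) (u : nat -> nat -> R) (z : nat -> nat).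
Hypotheses (z_gt0 : forall m, (0 < z m)%N) (z_ge : forall m, (m <= z m)%N).
Hypothesis z_tol : forall m, 1 / (arr * (z m)%:R) <= tolerance m.
Hypothesis y_tol : forall m i, `|(y m i)%:R / (z m)%:R - x0 i| <= tolerance m.
Hypothesis good : forall m,
  path_good Q eps l N0 C L lam (y m) (u m) (z m) (horizon m * z m) (tolerance m).

Theorem limit_of_paths : exists f : R -> 'I_(N * N) -> R,
  fluid_limits Q eps l C L lam x0 f /\
  forall s de M, 0 < de -> exists m : nat, [/\ (M <= m)%N, s <= m%:R &
    forall t i, 0 <= t <= s ->
      `|(chain Q eps l N0 C L lam (y m) (u m) ((z m)%:R * t) i)%:R / (z m)%:R - f t i| <= de].
Proof.
pose cs m := jump_chain Q eps l N0 C L lam (y m) (u m).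
pose ix m t := jump_index Q eps l N0 C L lam (y m) (u m) ((z m)%:R * t).
pose X m i t : R := (cs m (ix m t) i)%:R / (z m)%:R.
pose D m i t : R := departed Q eps l N0 C L lam (y m) (u m) (z m) i t.
pose rho m i t : R := dep (cs m (ix m t)) i.
(* The clock error is at most 4 tolerances; the 2 accounts for the martingale and for the initial
   condition. *)
pose cst : R := 2 + (arr + 2 * dmax) * 4.
pose e m : R := cst * tolerance m.
have a0 : 0 < arr by exact: arr_rate_gt0.
have d0 : 0 <= dmax by exact: max_dep_ge0.
have zR m : 0 < (z m)%:R :> R by rewrite ltr0n.
have Eexp m j : 0 <= - ln (u m (2 * j)%N) by have [H _ _] := good m; exact: (H j).1.
have hor m := jump_time_horizon (z_gt0 m) (good m).
have err_le m : 3 * tolerance m + 1 / (arr * (z m)%:R) <= 4 * tolerance m.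
  by have := z_tol m; lra.
have tol0 m := tolerance_gt0 m.
have cst0 m : 0 <= arr * tolerance m by rewrite mulr_ge0// ltW.
have cst1 m : 0 <= dmax * tolerance m by rewrite mulr_ge0// ltW.
have He : e @ \oo --> (0 : R).
  rewrite -(mulr0 cst); apply: cvgMr; exact: cvg_harmonic.
have HX m i t : 0 <= t <= m%:R -> `|X m i t - (x0 i + arr * t - D m i t)| <= e m.
  move=> tm; have := @path_balance R Q eps N l N0 C L lam eps_gt0 N_gt0 N0_gt0 C_gt0 L_gt0 lam_gt0
    w_ge0 w_diag (y m) (u m) (Eexp m) (z m) _ _ m%:R (good m) (z_gt0 m) (hor m) i t tm.
  have := y_tol m i.
  have h : arr * (3 * tolerance m + 1 / (arr * (z m)%:R)) <= arr * (4 * tolerance m).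
    by rewrite ler_pM2l.
  rewrite -/(ix m t) -/(cs m) -/(X m i t) -/(D m i t) => h1 h2.
  have -> : X m i t - (x0 i + arr * t - D m i t) =
    (X m i t - ((y m i)%:R / (z m)%:R + arr * t - D m i t)) + ((y m i)%:R / (z m)%:R - x0 i) by ring.
  rewrite (le_trans (ler_normD _ _))// /e /cst.
  have := tol0 m; have := cst0 m; have := cst1 m; lra.
have HX0 m i t : 0 <= t <= m%:R -> 0 <= X m i t by move=> _; rewrite divr_ge0.
have HD0 m i : `|D m i 0| <= e m.
  have := @departed_init R Q eps N l N0 C L lam eps_gt0 N_gt0 N0_gt0 C_gt0 L_gt0 lam_gt0
    w_ge0 w_diag (y m) (u m) (Eexp m) (z m) _ _ m%:R (good m) (z_gt0 m) (hor m) i (ler0n _ _).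
  move=> /le_trans; apply.
  have h : dmax * (3 * tolerance m + 1 / (arr * (z m)%:R)) <= dmax * (4 * tolerance m).
    by rewrite ler_wpM2l.
  apply: (le_trans h); rewrite /e /cst.
  have := tol0 m; have := cst0 m; have := cst1 m; lra.
have Hrho m i t : 0 <= t <= m%:R -> 0 <= rho m i t <= dmax by move=> _; exact: dep_rate_bnd.
have HD m i s t al be : 0 <= s -> s <= t -> t <= m%:R ->
  (forall r, s <= r <= t -> al <= rho m i r <= be) ->
  al * (t - s) - e m <= D m i t - D m i s <= be * (t - s) + e m.
  move=> s0 st tm Hr.
  have /andP[] := @departed_incr R Q eps N l N0 C L lam eps_gt0 N_gt0 N0_gt0 C_gt0 L_gt0 lam_gt0
    w_ge0 w_diag (y m) (u m) (Eexp m) (z m) _ _ m%:R (good m) (z_gt0 m) (hor m) i s t al be s0 st tm Hr.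
  have h : dmax * (3 * tolerance m + 1 / (arr * (z m)%:R)) <= dmax * (4 * tolerance m).
    by rewrite ler_wpM2l.
  have h' : 2 * dmax * (3 * tolerance m + 1 / (arr * (z m)%:R)) <= e m.
    rewrite /e /cst -mulrA; have := tol0 m; have := cst0 m; lra.
  rewrite -/(D m i t) -/(D m i s) => h1 h2; apply/andP; split; lra.
have Hloc (x : 'I_(N * N) -> R) i : (forall k, 0 <= x k) -> 0 < interf w x i ->
  forall ep, 0 < ep -> exists2 ga, 0 < ga & \forall m \near \oo,
    forall r, 0 <= r <= m%:R -> (forall k, `|X m k r - x k| < ga) ->
      `|rho m i r - share w (unit_rate C L) x i| <= ep.
  move=> _ S0 ep ep0.
  have [ga ga0 [z0 Hz]] := @dep_rate_loc R Q eps N l N0 C L C_gt0 L_gt0 w_ge0 w_diag w_le1 x i S0 ep ep0.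
  exists ga => //; exists z0 => // m /= zm r _ Hx.
  by apply: (Hz (z m)) => //; exact: leq_trans (z_ge m).
have [x [Dl [[Dl0 xE] Dlinc x_ge0 Hae Happ]]] := @fluid_limit_exists R _ w arr (unit_rate C L) dmax x0
  w_ge0 w_diag w_connected a0 d0 X D rho e He HX HX0 HD0 Hrho HD Hloc.
exists (fun t i => x i t); split; last first.
  by move=> s de M de0; have [m Hm] := Happ s de M de0; exists m.
split; first by apply/funext => i; rewrite xE Dl0 mulr0 addr0 subr0.
split; first by move=> t t0 i; exact: x_ge0.
exists Dl; split => //; split.
  by move=> i s t s0 st; rewrite -subr_ge0; have /andP[] := Dlinc i s t s0 st.
split.
  move=> i; exists dmax.
  have W s t : 0 <= s -> s <= t -> `|Dl i s - Dl i t| <= dmax * `|s - t|.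
    move=> s0 st; have /andP[h1 h2] := Dlinc i s t s0 st.
    by rewrite distrC ger0_norm// distrC ger0_norm ?subr_ge0.
  move=> s t s0 t0; have [st|/ltW ts] := leP s t; first exact: W.
  by rewrite distrC [`|s - t|]distrC; exact: W.
split; first by move=> i t t0; rewrite xE.
have F := ae_filter_ringOfSetsType (@lebesgue_measure R).
apply: filterS Hae => t Ht t0; have [H1 H2] := Ht t0; split.
  move=> sp i; have [|xi dxi] := H1 _ i.
    apply: contrapT => nx; move: sp; rewrite ltNge => /negP; apply.
    apply: sup_norm_le => // k; rewrite normr_le0; apply: contrapT => /negP xk.
    by apply: nx; exists k.
  (* No coordinate vanishes at such a time, so the branch with value 0 does not occur. *)
  rewrite (negbTE xi); move: dxi; congr is_derive.
  by rewrite /share /unit_rate /interf (invfM (L * ln 2)) !mulrA [C * _ * x i t]mulrAC.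
move=> sp i; apply: H2 => k; apply/eqP; rewrite -normr_le0 -sp.
exact: (sup_norm_ge (fun i => x i t)).
Qed.
End LimitOfPaths.

(** * Existence of fluid limits and convergence in probability *)

Theorem mainTheorem10
  (R : realType) (Q eps : R) (N : nat) (l : R -> R) (N0 C L lam : R)
  (hQ : 0 < Q) (heps : 0 < eps) (hN : (0 < N)%N) (hadm : 2 * Q / eps = N%:R)
  (hl_nonneg : forall r, 0 <= r -> 0 <= l r)
  (hl_bdd : exists M : R, forall r, 0 <= r -> l r <= M)
  (hl_noninc : forall r s, 0 <= r -> r <= s -> l s <= l r)
  (hl0 : l 0 = 1)
  (hN0 : 0 < N0) (hC : 0 < C) (hL : 0 < L) (hlam : 0 < lam)
  (d : measure_display) (T : measurableType d) (P : probability T R)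
  (U : nat -> T -> R) (hU : iid_uniform01 P U)
  (X0 : nat -> 'I_(N * N) -> nat) (z : nat -> nat) (x0 : 'I_(N * N) -> R)
  (hz_pos : forall k, (0 < z k)%N)
  (hz_inf : forall M : nat, exists K, forall k, (K <= k)%N -> (M <= z k)%N)
  (hx0 : forall i, 0 <= x0 i)
  (hconv : forall i, (fun k => (X0 k i)%:R / (z k)%:R) @ \oo --> x0 i) :
  fluid_limits Q eps l C L lam x0 !=set0 /\
  forall s delta : R, 0 < s -> 0 < delta ->
    (* the (outer) probability of the deviation event tends to 0 *)
    exists B : nat -> set T,
      (forall k, measurable (B k)) /\
      (forall k,
         [set w | (ereal_inf
            [set ereal_sup
               [set (sup_norm (fun i =>
                       (chain Q eps l N0 C L lam (X0 k) (fun m => U m w)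
                          ((z k)%:R * t) i)%:R / (z k)%:R - f t i))%:E
               | t in [set t : R | (0 <= t <= s)%R]]
            | f in fluid_limits Q eps l C L lam x0] > delta%:E)%E] `<=` B k) /\
      (fun k => P (B k)) @ \oo --> 0%E.
Proof.
pose w := @l_eps R Q eps N l.
have w_ge0 : forall i j, 0 <= w i j by move=> i j; exact: l_eps_ge0.
have w_le1 : forall i j, w i j <= 1 by move=> i j; exact: l_eps_le1.
have w_diag : forall i, w i i = 1 by move=> i; exact: l_eps_diag.
have w_conn : forall Z : pred 'I_(N * N), (exists i, Z i) ->
  (forall i k, Z i -> w i k = 1 -> Z k) -> forall k, Z k by exact: l_eps_connected.
have a0 : 0 < arr_rate eps lam by exact: arr_rate_gt0.
have lim := @limit_of_paths R Q eps N l N0 C L lam heps hN hN0 hC hL hlam w_ge0 w_diag w_le1 w_conn x0.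
pose gd m k u := path_good Q eps l N0 C L lam (X0 k) u (z k)
  (horizon eps N N0 C L lam m * z k) (tolerance R m).
have prob_good m : exists (K : R) (z0 : nat), forall k, (z0 <= z k)%N ->
    exists B : set T, [/\ measurable B, (P B <= (K / (z k)%:R)%:E)%E &
      forall om, ~ B om -> gd m k (fun j => U j om)].
  have [K [z0 H]] := @good_prob R Q eps N l N0 C L lam heps hN hN0 hC hL hlam w_ge0 w_diag
    d T P U hU (horizon eps N N0 C L lam m) (tolerance R m) (tolerance_gt0 R m).
  by exists K, z0 => k zk; exact: H.
have near_start m : exists K0, forall k, (K0 <= k)%N ->
    [/\ (m <= z k)%N, 1 / (arr_rate eps lam * (z k)%:R) <= tolerance R m &
      forall i, `|(X0 k i)%:R / (z k)%:R - x0 i| <= tolerance R m].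
  have [K1 HK1] := hz_inf (maxn m (Num.truncn (m.+1%:R / arr_rate eps lam)).+1).
  have [K2 _ HK2] : \forall k \near \oo, forall i, `|(X0 k i)%:R / (z k)%:R - x0 i| <= tolerance R m.
    apply: filter_forall => i; have := hconv i; move/cvgrPdist_le => /(_ _ (tolerance_gt0 R m)).
    by apply: filterS => k; rewrite distrC.
  exists (maxn K1 K2) => k; rewrite geq_max => /andP[k1 k2].
  have := HK1 k k1; rewrite geq_max => /andP[mz zz]; split => //; last exact: HK2.
  have zR : 0 < (z k)%:R :> R by rewrite ltr0n.
  rewrite /tolerance ler_pdivrMr ?mulr_gt0// [_^-1 * _]mulrC ler_pdivlMr ?ltr0n// mul1r mulrC.
  by rewrite -ler_pdivrMr// ltW// (lt_le_trans (truncnS_gt _))// ler_nat.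
have small_prob (K ep : R) : 0 < ep -> exists k0, forall k, (k0 <= k)%N -> K / (z k)%:R <= ep.
  move=> ep0; have [k0 Hk0] := hz_inf (Num.truncn (K / ep)).+1.
  exists k0 => k /Hk0 zk; have zR : 0 < (z k)%:R :> R by rewrite ltr0n.
  rewrite ler_pdivrMr// mulrC -ler_pdivrMr// ltW//.
  by rewrite (lt_le_trans (truncnS_gt _))// ler_nat.
(* For large [k] the bad event has probability at most 1/2, so some sample point is good; these
   paths yield a fluid limit. *)
have exists_good m : exists (k : nat) (u : nat -> R), [/\ gd m k u, (m <= z k)%N,
    1 / (arr_rate eps lam * (z k)%:R) <= tolerance R m &
    forall i, `|(X0 k i)%:R / (z k)%:R - x0 i| <= tolerance R m].
  have [K [z0 HB]] := prob_good m; have [K0 HK0] := near_start m.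
  have h20 : 0 < 2^-1 :> R by rewrite invr_gt0.
  have [k1 Hk1] := small_prob K 2^-1 h20; have [k2 Hk2] := hz_inf z0.
  pose k := maxn K0 (maxn k1 k2).
  have [h1 h2 h3] := HK0 k (leq_maxl _ _).
  have kk1 : (k1 <= k)%N by rewrite /k !leq_max leqnn !orbT.
  have kk2 : (k2 <= k)%N by rewrite /k !leq_max leqnn !orbT.
  have [B [mB PB HBg]] := HB k (Hk2 k kk2).
  have [om nB] : exists om, ~ B om.
    apply: contrapT => nB.
    have BT : B = setT.
      by apply/seteqP; split => // om _; apply: contrapT => h; apply: nB; exists om.
    move: PB; rewrite BT probability_setT lee_fin; move/le_trans => /(_ _ (Hk1 k kk1)).
    by lra.
  by exists k, (fun j => U j om); split => //; exact: HBg.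
split.
  have [kf Hk] := choice exists_good; have [uf Hu] := choice Hk.
  have [|||||f [Sf _]] := lim (fun m => X0 (kf m)) uf (fun m => z (kf m)).
  - by move=> m; exact: hz_pos.
  - by move=> m; have [] := Hu m.
  - by move=> m; have [] := Hu m.
  - by move=> m; have [] := Hu m.
  - by move=> m; have [] := Hu m.
  - by exists f.
move=> s delta s0 delta0.
pose close k u := exists f, fluid_limits Q eps l C L lam x0 f /\ forall t, 0 <= t <= s ->
  sup_norm (fun i => (chain Q eps l N0 C L lam (X0 k) u ((z k)%:R * t) i)%:R / (z k)%:R - f t i) <= delta.
(* A level [m] uniform over all good paths, by compactness: otherwise each level has a good path
   that is not close, and [limit_of_paths] makes one of these close to a fluid limit. *)
have [m [K0 HK0]] : exists m K0, forall k, (K0 <= k)%N -> forall u, gd m k u -> close k u.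
  apply: contrapT => nH.
  have bad m : exists (k : nat) (u : nat -> R), [/\ gd m k u, (m <= z k)%N,
    1 / (arr_rate eps lam * (z k)%:R) <= tolerance R m,
    forall i, `|(X0 k i)%:R / (z k)%:R - x0 i| <= tolerance R m & ~ close k u].
    have [K0 HK0] := near_start m.
    apply: contrapT => nex; apply: nH; exists m, K0 => k kK u gu.
    apply: contrapT => ncl; apply: nex; exists k, u.
    by have [h1 h2 h3] := HK0 k kK; split.
  have [kf Hk] := choice bad; have [uf Hu] := choice Hk.
  have [|||||f [Sf /(_ s delta 0%N delta0)[m [_ _ Hm]]]] := lim (fun m => X0 (kf m)) uf (fun m => z (kf m)).
  - by move=> m; exact: hz_pos.
  - by move=> m; have [] := Hu m.
  - by move=> m; have [] := Hu m.
  - by move=> m; have [] := Hu m.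
  - by move=> m; have [] := Hu m.
  have [_ _ _ _] := Hu m; apply; exists f; split => // t ts.
  by apply: sup_norm_le; [exact: ltW | move=> i; exact: Hm].
have [K [z0 HB]] := prob_good m; have [k2 Hk2] := hz_inf z0.
have exB k : exists B : set T, [/\ measurable B,
    (maxn K0 k2 <= k)%N -> (P B <= (K / (z k)%:R)%:E)%E &
    forall om, ~ B om -> close k (fun j => U j om)].
  have [kk|kk] := leqP (maxn K0 k2) k; last first.
    (* Finitely many early indices get the trivial event, which does not affect the limit. *)
    exists setT; split => //.
    by move=> om h; exfalso; apply: h.
  move: kk; rewrite geq_max => /andP[kK0 kk2].
  have [B [mB PB HBg]] := HB k (Hk2 k kk2).
  by exists B; split => // om /HBg; exact: HK0.
have [B HBk] := choice exB.
exists B; split; first by move=> k; have [] := HBk k.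
split.
  move=> k om /= hom; apply: contrapT => nB; have [_ _ Hc] := HBk k.
  have [f [Sf Hf]] := Hc om nB.
  move: hom; apply/negP; rewrite -leNgt.
  apply: ge_ereal_inf; eexists; first by exists f.
  apply/ereal_supP => _ [t ts <-]; rewrite lee_fin; exact: Hf.
apply/fine_cvgP; split.
  by exists 0%N => // k _ /=; have [mB _ _] := HBk k; exact: fin_num_measure.
apply/cvgrPdist_le => ep ep0.
have [k3 Hk3] := small_prob K ep ep0.
exists (maxn (maxn K0 k2) k3) => // k /=; rewrite geq_max => /andP[kk kk3].
have [mB PB _] := HBk k.
rewrite sub0r normrN ger0_norm ?fine_ge0// -lee_fin fineK ?fin_num_measure//.
by rewrite (le_trans (PB kk))// lee_fin Hk3.
Unshelve. all: by end_near. Qed.
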